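(* The linear map $\theta: L\rightarrow \mathfrak{m}_{1,0}\Delta$ defined by $$\theta(X_1(m))=(t^{m}-\delta_{m_2,0})\, t_1\frac{\partial}{\partial t_1},\qquad \theta(X_2(m))=(t^{m}-\delta_{m_2,0})\, \frac{\partial}{\partial t_2},$$ for $m=(m_1,m_2)\in\mathbb{Z}\times \mathbb{Z}_+$, is a Lie algebra isomorphism.
   Context: All algebras are over $\mathbb{C}$; $\mathbb{Z}_+$ denotes the nonnegative integers. Let $A=\mathbb{C}[t_1^{\pm1},t_2]$, $\mathfrak{g}=\mathrm{Der}(A)$, $\partial_i=\frac{\partial}{\partial t_i}$, and for $m=(m_1,m_2)\in\mathbb{Z}\times\mathbb{Z}_+$ put $t^m=t_1^{m_1}t_2^{m_2}$; $\delta$ is the Kronecker delta. $A\#U(\mathfrak{g})$ is the smash product of $A$ with the Hopf algebra $U(\mathfrak{g})$ (universal enveloping algebra), where $\mathfrak{g}$ acts on $A$ by derivations: as a vector space it is $A\otimes U(\mathfrak{g})$, the element $f\otimes u$ is written $f\cdot u$, $A=A\cdot 1$ and $U(\mathfrak{g})=1\cdot U(\mathfrak{g})$ are subalgebras, $(f\cdot 1)(1\cdot u)=f\cdot u$, and $(1\cdot X)(f\cdot 1)=f\cdot X+X(f)\cdot 1$ for $X\in\mathfrak{g}$, $f\in A$. For $m\in\mathbb{Z}\times\mathbb{Z}_+$ and $k=1,2$ define in $A\#U(\mathfrak{g})$ $$X_k(m)=\sum_{i=0}^{m_2}(-1)^i\binom{m_2}{i}t_1^{-m_1}t_2^i\cdot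 t_1^{m_1+\delta_{k1}}t_2^{m_2-i}\partial_k-\delta_{m_2,0}\,1\cdot t_1^{\delta_{k1}}\partial_k .$$ In particular $X_k(0,0)=0$. $L$ is the Lie subalgebra of $A\#U(\mathfrak{g})$ (with the commutator bracket) spanned by all $X_k(m)$, $k=1,2$, $m\in\mathbb{Z}\times\mathbb{Z}_+$. $\mathfrak{m}_{1,0}$ is the maximal ideal of $A$ generated by $t_1-1$ and $t_2$, $\Delta=\mathrm{span}\{\frac{\partial}{\partial t_1},\frac{\partial}{\partial t_2}\}$, and $\mathfrak{m}_{1,0}\Delta$ is the Lie subalgebra of $\mathfrak{g}$ spanned by all $f\frac{\partial}{\partial t_i}$ with $f\in\mathfrak{m}_{1,0}$, $i=1,2$ (vector fields vanishing at the point $(1,0)$). *)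

(* Defs.v *)
From HB Require Import structures.
From mathcomp Require Import all_boot all_order all_algebra.
From mathcomp Require Import boolp classical_sets functions reals.
From mathcomp Require Import finmap complex monalg.

Set Implicit Arguments.
Unset Strict Implicit.
Unset Printing Implicit Defensive.

Import GRing.Theory.

Local Open Scope classical_set_scope.
Local Open Scope quotient_scope.
Local Open Scope ring_scope.

(* Several constructions below are locked, so that unification does not unfold
   them; foo_def is the actual definition of foo. *)
Fact lock_key : unit. Proof. exact: tt. Qed.

Section Span.
Context (F : comNzRingType) (V : lmodType F).

Definition submodule (P : set V) : Prop :=
  P 0 /\ forall (a : F) u v, P u -> P v -> P (a *: u + v).

Definition span (E : set V) : set V := smallest submodule E.

Lemma span_submodule E : submodule (span E).
Proof.
split=> [P [[P0 _] _] //|a u v hu hv P [sP EP]].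
by apply: sP.2; [apply: hu | apply: hv].
Qed.

Lemma span_gen (E : set V) x : E x -> span E x.
Proof. by move=> Ex P [_ EP]; apply: EP. Qed.

Lemma span_ind (E P : set V) :
  submodule P -> (forall x, E x -> P x) -> forall x, span E x -> P x.
Proof. by move=> sP EP x hx; apply: (hx P); split. Qed.

Definition in_span (E : set V) : {pred V} := [pred x | `[< span E x >]].

Lemma in_span_closed E : submod_closed (in_span E).
Proof.
have [h0 hD] := span_submodule E.
split=> [|a u v]; first exact/asboolP.
by move=> /asboolP hu /asboolP hv; apply/asboolP; exact: hD.
Qed.

HB.instance Definition _ E := GRing.isSubmodClosed.Build F V (in_span E)
  (in_span_closed E).

Definition lquot (E : set V) := Quotient.quot (in_span E).

HB.instance Definition _ E := GRing.Zmodule.on (lquot E).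

Definition lpi_def (E : set V) (x : V) : lquot E := \pi_(lquot E) x.
Definition lpi := locked_with lock_key lpi_def.
Definition lrepr (E : set V) (x : lquot E) : V := repr x.

Lemma lreprK E (x : lquot E) : lpi E (lrepr x) = x.
Proof. by rewrite /lpi unlock; exact: reprK. Qed.

Lemma lpi_eq E x y : lpi E x = lpi E y <-> span E (x - y).
Proof.
split=> [/eqP h|h]; [|apply/eqP]; move: h; rewrite /lpi unlock /lpi_def.
  by rewrite -Quotient.idealrBE => /asboolP.
by rewrite -Quotient.idealrBE => h; exact/asboolP.
Qed.

Lemma lpi_eq0 E x : lpi E x = 0 <-> span E x.
Proof.
have -> : 0 = lpi E 0 by rewrite /lpi unlock /lpi_def pi_zeror.
by rewrite lpi_eq subr0.
Qed.

Definition lquot_scale E (a : F) (x : lquot E) : lquot E :=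
  lpi E (a *: lrepr x).

Lemma lpiD E x y : lpi E (x + y) = lpi E x + lpi E y.
Proof. by rewrite /lpi unlock; exact: pi_addr. Qed.

Lemma lpiZ_subproof E a x : lpi E (a *: x) = lquot_scale a (lpi E x).
Proof.
apply/lpi_eq; rewrite -scalerBr -[_ *: _]addr0.
have [h0 hD] := span_submodule E; apply: hD => //.
by apply/lpi_eq; rewrite lreprK.
Qed.
End Span.

Section LinearFacts.
Context (F : comNzRingType) (V W : lmodType F) (h : V -> W).
Hypothesis hlin : linear h.

Lemma lin0 : h 0 = 0.
Proof. by rewrite -[in LHS](addNr 0) -scaleN1r hlin scaleN1r addNr. Qed.

Lemma linD u v : h (u + v) = h u + h v.
Proof. by rewrite -[u]scale1r hlin !scale1r. Qed.

Lemma linZ a u : h (a *: u) = a *: h u.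
Proof. by rewrite -[a *: u]addr0 hlin lin0 addr0. Qed.

Lemma linN u : h (- u) = - h u.
Proof. by rewrite -scaleN1r linZ scaleN1r. Qed.

Lemma linB u v : h (u - v) = h u - h v.
Proof. by rewrite linD linN. Qed.

Lemma lin_sum I (r : seq I) (G : I -> V) :
  h (\sum_(i <- r) G i) = \sum_(i <- r) h (G i).
Proof. exact: (big_morph h linD lin0). Qed.

Lemma lin_span (E : set V) :
  (forall x, E x -> h x = 0) -> forall x, span E x -> h x = 0.
Proof.
move=> hE; apply: (@span_ind _ _ E [set x | h x = 0]) => //.
split=> [|a u v]; rewrite /= ?lin0 // hlin => -> ->.
by rewrite scaler0 addr0.
Qed.
End LinearFacts.

Section LinearCombination.
Context (F : comNzRingType) (V W : lmodType F) (f h : V -> W).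
Hypotheses (fl : linear f) (hl : linear h).

Lemma lin_comb (c : F) : linear (fun x => c *: f x + h x).
Proof.
move=> d x y; rewrite fl hl !scalerDr !scalerA [c * d]mulrC.
by rewrite addrACA.
Qed.

Lemma lin_add : linear (fun x => f x + h x).
Proof. by move=> d x y; rewrite fl hl scalerDr addrACA. Qed.

Lemma lin_sub : linear (fun x => f x - h x).
Proof. by move=> d x y; rewrite fl hl scalerBr opprD addrACA. Qed.
End LinearCombination.

Lemma lin_comp (F : comNzRingType) (V W T : lmodType F) (f : W -> T) (h : V -> W) :
  linear f -> linear h -> linear (fun x => f (h x)).
Proof. by move=> fl hl a x y; rewrite hl fl. Qed.

Section LQuot.
Context (F : comNzRingType) (V : lmodType F) (E : set V).

Lemma lquot_scalerA a b (x : lquot E) :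
  lquot_scale a (lquot_scale b x) = lquot_scale (a * b) x.
Proof. by rewrite -[x]lreprK -!lpiZ_subproof scalerA. Qed.

Lemma lquot_scale1r : left_id 1 (@lquot_scale F V E).
Proof. by move=> x; rewrite -[x]lreprK -lpiZ_subproof scale1r. Qed.

Lemma lquot_scalerDr : right_distributive (@lquot_scale F V E) +%R.
Proof.
move=> a x y; rewrite -[x]lreprK -[y]lreprK -lpiD -!lpiZ_subproof -lpiD.
by rewrite scalerDr.
Qed.

Lemma lquot_scalerDl (x : lquot E) :
  {morph (@lquot_scale F V E)^~ x : a b / a + b}.
Proof.
by move=> a b /=; rewrite -[x]lreprK -!lpiZ_subproof -lpiD scalerDl.
Qed.

HB.instance Definition _ := GRing.Zmodule_isLmodule.Build F (lquot E)
  lquot_scalerA lquot_scale1r lquot_scalerDr lquot_scalerDl.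

Lemma lpi_linear : linear (lpi E).
Proof. by move=> a u v; rewrite lpiD lpiZ_subproof. Qed.

Definition llift (W : lmodType F) (h : V -> W) (q : lquot E) : W :=
  h (lrepr q).

Section Lift.
Context (W : lmodType F) (h : V -> W).
Hypotheses (hlin : linear h) (hE : forall x, E x -> h x = 0).

Lemma lliftE x : llift h (lpi E x) = h x.
Proof.
apply/eqP; rewrite -subr_eq0 /llift -linB //; apply/eqP.
by apply: (lin_span hlin hE); apply/lpi_eq; rewrite lreprK.
Qed.

Lemma llift_linear : linear (llift h).
Proof.
move=> a u v; rewrite -[u]lreprK -[v]lreprK -lpi_linear !lliftE.
exact: hlin.
Qed.
End Lift.
End LQuot.

Section MLin.
Context (F : comNzRingType) (K : choiceType) (W : lmodType F).

Definition mlin_def (h : K -> W) (x : {malg F[K]}) : W :=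
  \sum_(k <- msupp x) x@_k *: h k.
Definition mlin := locked_with lock_key mlin_def.

Lemma mlinE h x : mlin h x = \sum_(k <- msupp x) x@_k *: h k.
Proof. by rewrite /mlin unlock. Qed.

Lemma mlinEw (h : K -> W) (d : {fset K}) (x : {malg F[K]}) :
  (msupp x `<=` d)%fset -> mlin h x = \sum_(k <- d) x@_k *: h k.
Proof.
move=> le; rewrite mlinE [LHS](big_fset_incl _ le) => //= k kd /mcoeff_outdom ->.
by rewrite scale0r.
Qed.

Lemma mlinU (h : K -> W) c k : mlin h << c *g k >> = c *: h k.
Proof. by rewrite (mlinEw _ msuppU_le) big_seq_fset1 mcoeffUU. Qed.

Lemma mlin_linear (h : K -> W) : linear (mlin h).
Proof.
move=> a u v; pose d := (msupp u `|` msupp v)%fset.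
rewrite (@mlinEw h d (a *: u + v)); last first.
  apply: fsubset_trans (msuppD_le _ _) _.
  by apply: fsetSU; apply: msuppZ_le.
rewrite (@mlinEw h d u) ?fsubsetUl // (@mlinEw h d v) ?fsubsetUr //.
rewrite scaler_sumr -big_split /=; apply: eq_bigr => k _.
by rewrite mcoeffD mcoeffZ scalerDl scalerA.
Qed.

Lemma mlin_ext (f g : {malg F[K]} -> W) :
  linear f -> linear g -> (forall k, f << k >> = g << k >>) -> f =1 g.
Proof.
move=> fl gl fg x; rewrite [x]monalgE !lin_sum //; apply: eq_bigr => k _.
have -> : << x@_k *g k >> = x@_k *: << k >> :> {malg F[K]}.
  by apply/malgP => l; rewrite mcoeffZ !mcoeffU mulrnAr mulr1.
by rewrite !linZ // fg.
Qed.

Lemma eq_mlin (h1 h2 : K -> W) : h1 =1 h2 -> mlin h1 =1 mlin h2.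
Proof. by move=> h x; rewrite !mlinE; apply: eq_bigr => k _; rewrite h. Qed.

Lemma mlin_linear_fun (g1 g2 : K -> W) a x :
  mlin (fun k => a *: g1 k + g2 k) x = a *: mlin g1 x + mlin g2 x.
Proof.
rewrite !mlinE scaler_sumr -big_split /=; apply: eq_bigr => k _.
by rewrite scalerDr !scalerA mulrC.
Qed.
End MLin.

(* monalg only makes {malg F[K]} a ring when 1 is the only unit of the
   monoid K, which excludes groups such as int. *)
Definition monoid_alg (F : comNzRingType) (M : nmodType) : Type := {malg F[M]}.

Section MonoidAlg.
Context (F : comNzRingType) (M : nmodType).
Local Notation B := (monoid_alg F M).

HB.instance Definition _ := GRing.Lmodule.on B.

Definition mono_def (m : M) : B := << m >>.
Definition mono := locked_with lock_key mono_def.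

Lemma monoE m : mono m = << m >>.
Proof. by rewrite /mono unlock. Qed.

Definition mamul_def (x y : B) : B :=
  mlin (fun k => mlin (fun l => mono (k + l)) y) x.
Definition mamul := locked_with lock_key mamul_def.

Lemma mamul_linl y : linear (mamul^~ y).
Proof. by rewrite /mamul unlock; exact: mlin_linear. Qed.

Lemma mamul_linr x : linear (mamul x).
Proof.
move=> a u v; rewrite /mamul unlock /mamul_def -mlin_linear_fun //.
by apply: eq_mlin => k; rewrite mlin_linear.
Qed.

Lemma mamulU k l : mamul (mono k) (mono l) = mono (k + l).
Proof. by rewrite /mamul unlock /mamul_def !monoE !mlinU !scale1r monoE. Qed.

Lemma mamulC : commutative mamul.
Proof.
move=> x y; move: x; apply: mlin_ext => [||k].
- exact: mamul_linl.
- exact: mamul_linr.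
move: y; apply: mlin_ext => [||l].
- exact: mamul_linr.
- exact: mamul_linl.
by rewrite -!monoE !mamulU addrC.
Qed.

Lemma mamulA : associative mamul.
Proof.
move=> x y z; move: x; apply: mlin_ext => [||k].
- exact: mamul_linl.
- by move=> a u v; rewrite !mamul_linl.
move: y; apply: mlin_ext => [||l].
- by move=> a u v; rewrite mamul_linl mamul_linr.
- by move=> a u v; rewrite mamul_linr mamul_linl.
move: z; apply: mlin_ext => [||m].
- by move=> a u v; rewrite !mamul_linr.
- exact: mamul_linr.
by rewrite -!monoE !mamulU addrA.
Qed.

Lemma mamul1 : left_id (mono 0) mamul.
Proof.
apply: mlin_ext => [||l] //; first exact: mamul_linr.
by rewrite -monoE mamulU add0r.
Qed.

Lemma mamulDl : left_distributive mamul +%R.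
Proof. by move=> x y z; rewrite (linD (@mamul_linl z)). Qed.

Lemma mono0_neq0 : mono 0 != 0.
Proof.
by rewrite monoE; apply/eqP/malgP=> /(_ 0) /eqP; rewrite mcoeffUU mcoeff0 oner_eq0.
Qed.

HB.instance Definition _ := GRing.Zmodule_isComNzRing.Build B
  mamulA mamulC mamul1 mamulDl mono0_neq0.

Lemma mamul_scalerAl (a : F) (x y : B) : a *: (x * y) = (a *: x) * y.
Proof. exact/esym/(linZ (@mamul_linl y)). Qed.

HB.instance Definition _ := GRing.Lmodule_isLalgebra.Build F B mamul_scalerAl.
HB.instance Definition _ := GRing.Lalgebra_isComAlgebra.Build F B.

Lemma monoM k l : mono k * mono l = mono (k + l).
Proof. exact: mamulU. Qed.

Lemma mono_ext (W : lmodType F) (f g : B -> W) :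
  linear f -> linear g -> (forall k, f (mono k) = g (mono k)) -> f =1 g.
Proof. by move=> fl gl fg; apply: mlin_ext => // k; rewrite -monoE. Qed.
End MonoidAlg.

HB.mixin Record Lmodule_isLieAlgebra (F : comNzRingType) G
    of GRing.Lmodule F G := {
  lie : G -> G -> G;
  lie_linl : forall y (a : F) u v, lie (a *: u + v) y = a *: lie u y + lie v y;
  lie_linr : forall x (a : F) u v, lie x (a *: u + v) = a *: lie x u + lie x v;
  liexx : forall x, lie x x = 0;
  lie_jacobi :
    forall x y z, lie x (lie y z) + lie y (lie z x) + lie z (lie x y) = 0
}.

#[short(type="lieAlgType")]
HB.structure Definition LieAlgebra (F : comNzRingType) :=
  {G of GRing.Lmodule F G & Lmodule_isLieAlgebra F G}.

Section LieDefs.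
Context (F : comNzRingType) (G H : lieAlgType F).

Definition lie_subalgebra (L : set G) : Prop :=
  submodule L /\ forall x y, L x -> L y -> L (lie x y).

Definition linear_on (L : set G) (f : G -> H) : Prop :=
  forall (a : F) x y, L x -> L y -> f (a *: x + y) = a *: f x + f y.

(* Only the restriction of f to L matters; set_bij says that f maps L
   bijectively onto M. *)
Definition lie_iso (L : set G) (M : set H) (f : G -> H) : Prop :=
  [/\ linear_on L f,
      forall x y, L x -> L y -> f (lie x y) = lie (f x) (f y) &
      set_bij L M f].
End LieDefs.

Section Derivations.
Context (F : comNzRingType) (A : comAlgType F).

Definition derivation : {pred (A -> A)} :=
  [pred D : A -> A | `[< linear D /\ forall f g, D (f * g) = D f * g + f * D g >]].

Lemma derivation_closed : submod_closed derivation.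
Proof.
split=> [|a D E /asboolP[Dl DM] /asboolP[El EM]]; apply/asboolP.
  have zE (x : A) : (0 : A -> A) x = 0 by [].
  by split=> [a u v|f g]; rewrite !zE ?scaler0 ?mul0r ?mulr0 addr0.
have DE x : (a *: D + E) x = a *: D x + E x by [].
split=> [b u v|f g]; rewrite !DE.
  rewrite Dl El !scalerDr !scalerA [a * b]mulrC.
  by rewrite addrACA.
rewrite DM EM scalerDr addrACA mulrDl mulrDr.
by rewrite scalerAl scalerAr addrACA.
Qed.

HB.instance Definition _ := GRing.isSubmodClosed.Build F (A -> A) derivation
  derivation_closed.

Record der := Der { der_fun :> A -> A; _ : der_fun \in derivation }.

HB.instance Definition _ := [isSub for der_fun].
HB.instance Definition _ := [Choice of der by <:].
HB.instance Definition _ := [SubChoice_isSubLmodule of der by <:].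

Lemma der_linear (D : der) : linear D.
Proof. by case: D => D /= /asboolP[]. Qed.

Lemma derM (D : der) f g : D (f * g) = D f * g + f * D g.
Proof. by case: D => D /= /asboolP[]. Qed.

Lemma der1 (D : der) : D 1 = 0.
Proof.
apply: (addrI (D 1)); rewrite addr0.
by rewrite -[in RHS](mulr1 1) derM mulr1 mul1r.
Qed.

Lemma derP (D E : der) : (forall f, D f = E f) -> D = E.
Proof. by move=> DE; apply/val_inj/funext. Qed.

Lemma der_mem (D : A -> A) : linear D ->
  (forall f g, D (f * g) = D f * g + f * D g) -> D \in derivation.
Proof. by move=> *; apply/asboolP. Qed.

Lemma der_addE (a : F) (D E : der) f : (a *: D + E) f = a *: D f + E f.
Proof. by []. Qed.

Lemma der_lie_subproof (D E : der) :
  (fun f => D (E f) - E (D f)) \in derivation.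
Proof.
have [Dl El] := (der_linear D, der_linear E).
apply: der_mem => [a u v|f g].
  by rewrite !(Dl, El) scalerBr opprD addrACA.
rewrite !derM (linD Dl) (linD El) !derM mulrBl mulrBr.
rewrite !opprD !addrA.
by rewrite (AC 8%AC ((1*5)*(2*7)*(3*6)*(4*8))%AC) /= !subrr !addr0 !addrA.
Qed.

Definition der_lie (D E : der) : der := Der (der_lie_subproof D E).

Lemma der_lieE D E f : der_lie D E f = D (E f) - E (D f).
Proof. by []. Qed.

Lemma der_lie_linl E a (D1 D2 : der) :
  der_lie (a *: D1 + D2) E = a *: der_lie D1 E + der_lie D2 E.
Proof.
apply: derP => f; rewrite der_addE !der_lieE !der_addE (der_linear E).
by rewrite scalerBr opprD addrACA.
Qed.

Lemma der_liexx D : der_lie D D = 0.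
Proof. by apply: derP => f; rewrite der_lieE subrr. Qed.

Lemma der_lie_linr D a (E1 E2 : der) :
  der_lie D (a *: E1 + E2) = a *: der_lie D E1 + der_lie D E2.
Proof.
apply: derP => f; rewrite der_addE !der_lieE !der_addE (der_linear D).
by rewrite scalerBr opprD addrACA.
Qed.

Lemma der_lie_jacobi D E G :
  der_lie D (der_lie E G) + der_lie E (der_lie G D) + der_lie G (der_lie D E) = 0.
Proof.
apply: derP => f.
have dB (X : der) u v := linB (der_linear X) u v.
have dD (X Y : der) : (X + Y) f = X f + Y f by [].
rewrite !dD !der_lieE !dB !opprB !addrA.
rewrite (AC 12%AC ((1*12)*(2*7)*(3*10)*(4*5)*(6*11)*(8*9))%AC).
by rewrite /= !(subrr, addNr, addr0).
Qed.

HB.instance Definition _ := Lmodule_isLieAlgebra.Build F der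
  der_lie_linl der_lie_linr der_liexx der_lie_jacobi.

Lemma der_scale_subproof (f : A) (D : der) : (fun g => f * D g) \in derivation.
Proof.
apply: der_mem => [a u v|g h].
  by rewrite (der_linear D) mulrDr scalerAr.
by rewrite derM mulrDr !mulrA [f * g]mulrC.
Qed.

Definition der_scale (f : A) (D : der) : der := Der (der_scale_subproof f D).
End Derivations.

Notation "f *d D" := (der_scale f D) (at level 40) : ring_scope.

Section Tensor.
Context (F : comNzRingType) (M N : lmodType F).

Definition tensor_rel : set {malg F[(M * N)%type]} :=
  [set r | exists a x y n, r = << (a *: x + y, n) >> - a *: << (x, n) >> - << (y, n) >>]
  `|` [set r | exists a m x y, r = << (m, a *: x + y) >> - a *: << (m, x) >> - << (m, y) >>].

Definition tensor : Type := lquot tensor_rel.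

HB.instance Definition _ := GRing.Lmodule.on tensor.

Definition ptensor_def (m : M) (n : N) : tensor := lpi tensor_rel << (m, n) >>.
Definition ptensor := locked_with lock_key ptensor_def.

Lemma ptensorE m n : ptensor m n = lpi tensor_rel << (m, n) >>.
Proof. by rewrite /ptensor unlock. Qed.

Lemma ptensor_linl n : linear (ptensor^~ n).
Proof.
move=> a x y; rewrite !ptensorE -lpi_linear; apply/lpi_eq; apply: (@span_gen F _ tensor_rel).
by rewrite /tensor_rel /=; left; exists a, x, y, n; rewrite opprD addrA.
Qed.

Lemma ptensor_linr m : linear (ptensor m).
Proof.
move=> a x y; rewrite !ptensorE -lpi_linear; apply/lpi_eq; apply: (@span_gen F _ tensor_rel).
by rewrite /tensor_rel /=; right; exists a, m, x, y; rewrite opprD addrA.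
Qed.

Lemma tensor_ext (W : lmodType F) (f g : tensor -> W) : linear f -> linear g ->
  (forall m n, f (ptensor m n) = g (ptensor m n)) -> f =1 g.
Proof.
move=> fl gl fg x; rewrite -[x]lreprK; move: (lrepr x) => {x}.
apply: mlin_ext => [a u v|a u v|[m n]]; last by rewrite -ptensorE fg.
  by rewrite lpi_linear fl.
by rewrite lpi_linear gl.
Qed.

Definition tensor_lift_def (W : lmodType F) (b : M -> N -> W) (t : tensor) : W :=
  llift (mlin (fun k => b k.1 k.2)) t.
Definition tensor_lift := locked_with lock_key tensor_lift_def.

Section Lift.
Context (W : lmodType F) (b : M -> N -> W).
Hypotheses (bl : forall n, linear (b^~ n)) (br : forall m, linear (b m)).

Let b0 x : tensor_rel x -> mlin (fun k => b k.1 k.2) x = 0.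
Proof.
have ml := @mlin_linear F (M * N)%type W (fun k => b k.1 k.2).
case=> [[a [x1 [x2 [x3 ->]]]]|[a [x1 [x2 [x3 ->]]]]];
  by rewrite !(linB ml) (linZ ml) !mlinU /= !scale1r ?bl ?br addrAC addrK subrr.
Qed.

Lemma tensor_liftE m n : tensor_lift b (ptensor m n) = b m n.
Proof.
rewrite /tensor_lift unlock ptensorE /tensor_lift_def lliftE ?mlinU ?scale1r //.
exact: mlin_linear.
Qed.

Lemma tensor_lift_linear : linear (tensor_lift b).
Proof.
by rewrite /tensor_lift unlock; apply: llift_linear => //; exact: mlin_linear.
Qed.
End Lift.
End Tensor.

Section Enveloping.
Context (F : comNzRingType) (g : lieAlgType F).

Local Notation free_alg := {malg F[{fmonom g}]}.

Definition fgen_def (x : g) : free_alg := << fmu x >>.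
Definition fgen := locked_with lock_key fgen_def.

Lemma fgenE x : fgen x = << fmu x >>.
Proof. by rewrite /fgen unlock. Qed.

Definition env_rel : set free_alg :=
  [set r | exists a x y, r = fgen (a *: x + y) - a *: fgen x - fgen y]
  `|` [set r | exists x y, r = fgen x * fgen y - fgen y * fgen x - fgen (lie x y)].

Definition env_ideal_gen : set free_alg :=
  [set z | exists a r b, env_rel r /\ z = a * r * b].

(* The quotient of the free algebra on the set g by the two-sided ideal
   generated by env_rel. *)
Definition env : Type := lquot env_ideal_gen.

HB.instance Definition _ := GRing.Lmodule.on env.

Local Notation pi := (lpi env_ideal_gen).

Definition env_mul_def (u v : env) : env := pi (lrepr u * lrepr v).
Definition env_mul := locked_with lock_key env_mul_def.
Definition env_one : env := pi 1.
Definition env_inj_def (x : g) : env := pi (fgen x).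
Definition env_inj := locked_with lock_key env_inj_def.

Lemma env_injE x : env_inj x = pi (fgen x).
Proof. by rewrite /env_inj unlock. Qed.

Lemma free_scalerAr (a : F) (p q : free_alg) : a *: (p * q) = p * (a *: q).
Proof.
rewrite -[a *: q]mul_malgC mulrA; have -> : p * a%:MP = a *: p.
  rewrite malgM_def fgmulgU malgZ_def /fgscale; apply: eq_bigr => k _.
  by rewrite mulm1 mulrC.
by rewrite scalerAl.
Qed.

Lemma free_mul_linl (q : free_alg) : linear (fun p : free_alg => p * q).
Proof. by move=> a u v; rewrite mulrDl scalerAl. Qed.

Lemma free_mul_linr (p : free_alg) : linear (fun q : free_alg => p * q).
Proof. by move=> a u v; rewrite mulrDr free_scalerAr. Qed.

Lemma env_ideal_mull p z : span env_ideal_gen z -> span env_ideal_gen (p * z).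
Proof.
have [s0 sD] := span_submodule env_ideal_gen.
apply: (@span_ind _ _ _ [set z | span env_ideal_gen (p * z)]).
  split=> [|a u v /= hu hv] /=; first by rewrite mulr0.
  by rewrite (free_mul_linr p a u v); exact: sD hu hv.
move=> _ [a [r [b [hr ->]]]]; apply: (@span_gen F _ env_ideal_gen).
by exists (p * a), r, b; rewrite !mulrA.
Qed.

Lemma env_ideal_mulr p z : span env_ideal_gen z -> span env_ideal_gen (z * p).
Proof.
have [s0 sD] := span_submodule env_ideal_gen.
apply: (@span_ind _ _ _ [set z | span env_ideal_gen (z * p)]).
  split=> [|a u v /= hu hv] /=; first by rewrite mul0r.
  by rewrite (free_mul_linl p a u v); exact: sD hu hv.
move=> _ [a [r [b [hr ->]]]]; apply: (@span_gen F _ env_ideal_gen).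
by exists a, r, (b * p); split; [exact: hr | exact/esym/mulrA].
Qed.

Lemma env_piM p q : env_mul (pi p) (pi q) = pi (p * q).
Proof.
have [s0 sD] := span_submodule env_ideal_gen.
rewrite /env_mul unlock; apply/lpi_eq; set p' := lrepr _; set q' := lrepr _.
have -> : p' * q' - p * q = 1 *: ((p' - p) * q') + p * (q' - q).
  by rewrite scale1r mulrBl mulrBr addrA subrK.
apply: sD; [apply: env_ideal_mulr | apply: env_ideal_mull];
  by apply/lpi_eq; rewrite lreprK.
Qed.

Lemma env_ext (W : lmodType F) (f h : env -> W) : linear f -> linear h ->
  (forall w, f (pi << w >>) = h (pi << w >>)) -> f =1 h.
Proof.
move=> fl hl fh x; rewrite -[x]lreprK; move: (lrepr x) => {x}.
by apply: mlin_ext => [a u v|a u v|w] //; rewrite lpi_linear ?fl ?hl.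
Qed.

Lemma env_mulA : associative env_mul.
Proof.
by move=> x y z; rewrite -[x]lreprK -[y]lreprK -[z]lreprK !env_piM mulrA.
Qed.

Lemma env_mul1 : left_id env_one env_mul.
Proof. by move=> x; rewrite -[x]lreprK env_piM mul1r. Qed.

Lemma env_1mul : right_id env_one env_mul.
Proof. by move=> x; rewrite -[x]lreprK env_piM mulr1. Qed.

Lemma env_mulDl : left_distributive env_mul +%R.
Proof.
move=> x y z; rewrite -[x]lreprK -[y]lreprK -[z]lreprK -lpiD !env_piM mulrDl.
exact: lpiD.
Qed.

Lemma env_mulDr : right_distributive env_mul +%R.
Proof.
move=> x y z; rewrite -[x]lreprK -[y]lreprK -[z]lreprK -lpiD !env_piM mulrDr.
exact: lpiD.
Qed.

Lemma env_mulZl (a : F) (x y : env) : a *: env_mul x y = env_mul (a *: x) y.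
Proof.
have pl := lpi_linear env_ideal_gen.
by rewrite -[x]lreprK -[y]lreprK env_piM -!(linZ pl) env_piM scalerAl.
Qed.

Lemma env_mulZr (a : F) (x y : env) : a *: env_mul x y = env_mul x (a *: y).
Proof.
have pl := lpi_linear env_ideal_gen.
by rewrite -[x]lreprK -[y]lreprK env_piM -!(linZ pl) env_piM free_scalerAr.
Qed.

Definition lie_module (V : lmodType F) (act : g -> V -> V) : Prop :=
  [/\ forall v, linear (act^~ v), forall x, linear (act x) &
      forall x y v, act (lie x y) v = act x (act y v) - act y (act x v)].

Definition word_act (V : Type) (act : g -> V -> V) (w : {fmonom g}) (v : V) :=
  foldr act v w.

Definition env_act_def (V : lmodType F) (act : g -> V -> V) (u : env) (v : V) : V :=
  llift (mlin (fun w => word_act act w v)) u.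
Definition env_act := locked_with lock_key env_act_def.

Section Action.
Context (V : lmodType F) (act : g -> V -> V) (hact : lie_module act).

Let fact (p : free_alg) v := mlin (fun w => word_act act w v) p.

Let fact_linl v : linear (fact^~ v). Proof. exact: mlin_linear. Qed.

Let word_act_linear w : linear (word_act act w).
Proof.
case: hact => _ hr _ a u v; rewrite /word_act.
by elim: (fmonom_val w) => //= x s ->; rewrite hr.
Qed.

Let fact_linr p : linear (fact p).
Proof.
move=> a u v; rewrite /fact -mlin_linear_fun; apply: eq_mlin => w.
by rewrite word_act_linear.
Qed.

Let word_actM w1 w2 v :
  word_act act (mmul w1 w2) v = word_act act w1 (word_act act w2 v).
Proof. by rewrite /word_act fmM foldr_cat. Qed.

Let factU w v : fact << w >> v = word_act act w v.
Proof. by rewrite /fact mlinU scale1r. Qed.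

Let factM p q v : fact (p * q) v = fact p (fact q v).
Proof.
move: p; apply: mlin_ext => [a x y|a x y|w1].
- by rewrite free_mul_linl fact_linl.
- by rewrite fact_linl.
move: q; apply: mlin_ext => [a x y|a x y|w2].
- by rewrite free_mul_linr fact_linl.
- by rewrite fact_linl fact_linr.
by rewrite malgM_def fgmulUU mulr1 !factU word_actM.
Qed.

Let fact_gen x v : fact (fgen x) v = act x v.
Proof. by rewrite fgenE factU /word_act fmuE. Qed.

Let fact_gen2 x y v : fact (fgen x * fgen y) v = act x (act y v).
Proof. by rewrite factM (fact_gen x) fact_gen. Qed.

Let fact_rel r v : env_rel r -> fact r v = 0.
Proof.
have [hl hr hb] := hact; have fl := fact_linl v.
case=> [[a [x [y ->]]]|[x [y ->]]]; rewrite !(linB fl).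
  by rewrite (linZ fl) !fact_gen hl addrAC addrK subrr.
transitivity (act x (act y v) - act y (act x v) - act (lie x y) v).
  by congr (_ - _ - _); [exact: fact_gen2 | exact: fact_gen2 | exact: fact_gen].
by rewrite hb subrr.
Qed.

Let fact_ideal v p : env_ideal_gen p -> fact p v = 0.
Proof.
move=> [a [r [b [hr ->]]]]; rewrite !factM (fact_rel _ hr).
exact: (lin0 (fact_linr a)).
Qed.

Let env_actE p v : env_act act (pi p) v = fact p v.
Proof.
rewrite /env_act unlock.
by apply: lliftE; [exact: fact_linl | move=> x; exact: fact_ideal].
Qed.

Lemma env_act_linl v : linear (fun u => env_act act u v).
Proof.
rewrite /env_act unlock.
by apply: llift_linear; [exact: fact_linl | move=> x; exact: fact_ideal].
Qed.

Lemma env_act_linr u : linear (env_act act u).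
Proof. by rewrite -[u]lreprK => a x y; rewrite !env_actE fact_linr. Qed.

Lemma env_actM u u' v :
  env_act act (env_mul u u') v = env_act act u (env_act act u' v).
Proof. by rewrite -[u]lreprK -[u']lreprK env_piM !env_actE factM. Qed.

Lemma env_act1 v : env_act act env_one v = v.
Proof. by rewrite env_actE factU /word_act fm1. Qed.

Lemma env_act_inj x v : env_act act (env_inj x) v = act x v.
Proof. by rewrite env_injE env_actE fact_gen. Qed.

Lemma env_act_word w v : env_act act (pi << w >>) v = word_act act w v.
Proof. by rewrite env_actE factU. Qed.
End Action.

Lemma env_act_morph (V W : lmodType F) (a : g -> V -> V) (b : g -> W -> W)
    (phi : V -> W) : lie_module a -> lie_module b -> linear phi ->
  (forall x v, phi (a x v) = b x (phi v)) ->
  forall u v, phi (env_act a u v) = env_act b u (phi v).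
Proof.
move=> ha hb hphi ab u v; move: u; apply: env_ext => [c x y|c x y|w].
- by rewrite env_act_linl // hphi.
- by rewrite env_act_linl.
rewrite !env_act_word // /word_act.
by elim: (fmonom_val w) => //= x s <-; rewrite ab.
Qed.

Lemma env_one_neq0 : env_one != 0.
Proof.
have h : lie_module (fun (_ : g) (_ : F^o) => 0).
  by split=> [v a x y|x a u v|x y v]; rewrite ?scaler0 ?addr0 ?subrr.
apply/eqP => e; have := env_act1 h 1; rewrite e.
by rewrite (lin0 (env_act_linl h 1)) => /eqP; rewrite eq_sym oner_eq0.
Qed.

HB.instance Definition _ := GRing.Zmodule_isNzRing.Build env
  env_mulA env_mul1 env_1mul env_mulDl env_mulDr env_one_neq0.
HB.instance Definition _ := GRing.Lmodule_isLalgebra.Build F env env_mulZl.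
HB.instance Definition _ := GRing.Lalgebra_isAlgebra.Build F env env_mulZr.

Lemma env_inj_linear : linear env_inj.
Proof.
move=> a x y; rewrite !env_injE -lpi_linear; apply/lpi_eq.
apply: (@span_gen F _ env_ideal_gen).
exists 1, (fgen (a *: x + y) - (a *: fgen x + fgen y)), 1.
rewrite mul1r mulr1; split=> //.
by left; exists a, x, y; rewrite opprD addrA.
Qed.

Lemma env_inj_lie x y :
  env_inj (lie x y) = env_inj x * env_inj y - env_inj y * env_inj x.
Proof.
have pl := lpi_linear env_ideal_gen.
have mE (u v : env) : u * v = env_mul u v by [].
rewrite !env_injE !mE !env_piM -(linB pl); apply/esym/lpi_eq.
apply: (@span_gen F _ env_ideal_gen).
exists 1, (fgen x * fgen y - fgen y * fgen x - fgen (lie x y)), 1.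
by rewrite mul1r mulr1; split=> //; right; exists x, y.
Qed.

Definition env_regular (x : g) (u : env) : env := env_inj x * u.

Lemma env_regular_module : lie_module env_regular.
Proof.
split=> [v a x y|x a u v|x y v]; rewrite /env_regular.
- by rewrite env_inj_linear mulrDl scalerAl.
- by rewrite mulrDr scalerAr.
- by rewrite env_inj_lie mulrBl !mulrA.
Qed.

Lemma env_act_regular u v : env_act env_regular u v = u * v.
Proof.
have h := env_regular_module.
move: u; apply: env_ext => [c x y|c x y|w].
- by rewrite env_act_linl.
- by rewrite mulrDl scalerAl.
rewrite env_act_word // /word_act.
have -> : w = FMonom (fmonom_val w) by case: w.
elim: (fmonom_val w) => /= [|x s ->].
  by rewrite (_ : << _ >> = 1) ?mul1r // -fmoneE.
rewrite /env_regular mulrA; congr (_ * _).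
have mE (u u' : env) : u * u' = env_mul u u' by [].
by rewrite mE env_injE env_piM fgenE malgM_def fgmulUU mulr1 fmuE /mmul /= fmmulE.
Qed.
End Enveloping.

Section Smash.
Context (F : comNzRingType) (A : comAlgType F).
Local Notation g := (der A).
Local Notation U := (env g).

Definition smash : Type := tensor A U.

HB.instance Definition _ := GRing.Lmodule.on smash.

Definition smash_tensor (f : A) (u : U) : smash := ptensor f u.
Local Notation "f # u" := (smash_tensor f u) (at level 30).

Definition smash_scale_def (f : A) : smash -> smash :=
  tensor_lift (fun a u => (f * a) # u).
Definition smash_scale := locked_with lock_key smash_scale_def.

(* X * (a # u) = X(a) # u + a # (X * u), that is, X acts through its coproduct
   X (x) 1 + 1 (x) X *)
Definition smash_act_def (X : g) : smash -> smash :=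
  tensor_lift (fun a u => X a # u + a # (env_inj X * u)).
Definition smash_act := locked_with lock_key smash_act_def.

(* (f # u) * t is f times the image of t under u, where U(g) acts on smash by
   extending smash_act; this is the usual formula
   (f # u) * (h # v) = sum f * u_1(h) # (u_2 * v). *)
Definition smash_mul_def (s t : smash) : smash :=
  tensor_lift (fun f u => smash_scale f (env_act smash_act u t)) s.
Definition smash_mul := locked_with lock_key smash_mul_def.

Definition smash_one : smash := 1 # 1.

Let tl u : linear (fun f => f # u). Proof. exact: ptensor_linl. Qed.
Let tr f : linear (smash_tensor f). Proof. exact: ptensor_linr. Qed.

Let mulr_lin (f : A) : linear (fun a : A => f * a).
Proof. by move=> a u v; rewrite mulrDr scalerAr. Qed.

Let envr_lin (x : U) : linear (fun u : U => x * u).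
Proof. by move=> a u v; rewrite mulrDr scalerAr. Qed.

Lemma smash_ext (W : lmodType F) (f h : smash -> W) : linear f -> linear h ->
  (forall a u, f (a # u) = h (a # u)) -> f =1 h.
Proof. exact: tensor_ext. Qed.

Let sc_l f u : linear (fun a => (f * a) # u).
Proof. exact: lin_comp (@tl u) (@mulr_lin f). Qed.

Lemma smash_scaleE f a u : smash_scale f (a # u) = (f * a) # u.
Proof.
rewrite /smash_scale unlock.
by apply: tensor_liftE => [n|m]; [apply: sc_l | apply: tr].
Qed.

Lemma smash_scale_linr f : linear (smash_scale f).
Proof.
rewrite /smash_scale unlock.
by apply: tensor_lift_linear => [n|m]; [apply: sc_l | apply: tr].
Qed.

Let tD u a b : (a + b) # u = a # u + b # u.
Proof. exact: linD (@tl u) a b. Qed.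

Let tlE u c a b : (c *: a + b) # u = c *: (a # u) + b # u.
Proof. exact: tl. Qed.

Let trE f c a b : f # (c *: a + b) = c *: (f # a) + f # b.
Proof. exact: tr. Qed.

Let trB f a b : f # (a - b) = f # a - f # b.
Proof. exact: linB (@tr f) a b. Qed.

Let scD f s t : smash_scale f (s + t) = smash_scale f s + smash_scale f t.
Proof. exact: linD (@smash_scale_linr f) s t. Qed.

Lemma smash_scale_linl s : linear (smash_scale^~ s).
Proof.
move=> c f h; move: s; apply: smash_ext => [||a u].
- exact: smash_scale_linr.
- exact: lin_comb (@smash_scale_linr f) (@smash_scale_linr h) c.
by rewrite 3!smash_scaleE mulrDl -scalerAl tlE.
Qed.

Lemma smash_scaleA f h s : smash_scale f (smash_scale h s) = smash_scale (f * h) s.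
Proof.
move: s; apply: smash_ext => [||a u].
- exact: lin_comp (@smash_scale_linr f) (@smash_scale_linr h).
- exact: smash_scale_linr.
by rewrite (smash_scaleE h) (smash_scaleE f) smash_scaleE mulrA.
Qed.

Lemma smash_scale1 s : smash_scale 1 s = s.
Proof.
move: s; apply: smash_ext => [||a u] //; first exact: smash_scale_linr.
by rewrite smash_scaleE mul1r.
Qed.

Let act_l (X : g) u : linear (fun a => X a # u + a # (env_inj X * u)).
Proof. exact: lin_add (lin_comp (@tl u) (der_linear X)) (@tl _). Qed.

Let act_r (X : g) a : linear (fun u => X a # u + a # (env_inj X * u)).
Proof. exact: lin_add (@tr _) (lin_comp (@tr a) (@envr_lin (env_inj X))). Qed.

Lemma smash_actE X a u : smash_act X (a # u) = X a # u + a # (env_inj X * u).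
Proof.
rewrite /smash_act unlock.
by apply: tensor_liftE => [n|m]; [apply: act_l | apply: act_r].
Qed.

Lemma smash_act_linr X : linear (smash_act X).
Proof.
rewrite /smash_act unlock.
by apply: tensor_lift_linear => [n|m]; [apply: act_l | apply: act_r].
Qed.

Let actD X s t : smash_act X (s + t) = smash_act X s + smash_act X t.
Proof. exact: linD (@smash_act_linr X) s t. Qed.

Let smash_actE2 X Y a u : smash_act X (smash_act Y (a # u)) =
  (X (Y a) # u + Y a # (env_inj X * u))
  + (X a # (env_inj Y * u) + a # (env_inj X * env_inj Y * u)).
Proof. by rewrite (smash_actE Y) actD 2!smash_actE mulrA. Qed.

Lemma smash_act_linl s : linear (smash_act^~ s).
Proof.
move=> c X Y; move: s; apply: smash_ext => [||a u].
- exact: smash_act_linr.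
- exact: lin_comb (@smash_act_linr X) (@smash_act_linr Y) c.
rewrite 3!smash_actE env_inj_linear mulrDl -scalerAl trE der_addE tlE.
by rewrite [in RHS]scalerDr addrACA.
Qed.

Lemma smash_act_lie X Y s :
  smash_act (lie X Y) s = smash_act X (smash_act Y s) - smash_act Y (smash_act X s).
Proof.
have dbl (p q r w p' w' : smash) :
  (p - p') + (w - w') = ((p + q) + (r + w)) - ((p' + r) + (q + w')).
  rewrite !opprD !addrA.
  by rewrite [RHS](AC 8%AC ((1*5)*(2*7)*(3*6)*(4*8))%AC) /= !subrr !addr0 !addrA.
move: s; apply: smash_ext => [||a u].
- exact: smash_act_linr.
- exact: lin_sub (lin_comp (@smash_act_linr X) (@smash_act_linr Y))
    (lin_comp (@smash_act_linr Y) (@smash_act_linr X)).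
rewrite 2!smash_actE2 smash_actE env_inj_lie mulrBl trB.
have -> : lie X Y a # u = X (Y a) # u - Y (X a) # u.
  exact: linB (@tl u) (X (Y a)) (Y (X a)).
exact: dbl.
Qed.

Lemma smash_act_module : lie_module smash_act.
Proof.
split; [exact: smash_act_linl | exact: smash_act_linr | exact: smash_act_lie].
Qed.

Local Notation uact := (env_act smash_act).

Let uact_linl t : linear (fun u => uact u t).
Proof. exact: env_act_linl smash_act_module t. Qed.

Let uact_linr u : linear (uact u).
Proof. exact: env_act_linr smash_act_module u. Qed.

Lemma smash_act_scale (X : g) f s :
  smash_act X (smash_scale f s) =
  smash_scale (X f) s + smash_scale f (smash_act X s).
Proof.
move: s; apply: smash_ext => [||a u].
- exact: lin_comp (@smash_act_linr X) (@smash_scale_linr f).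
- exact: lin_add (@smash_scale_linr _)
    (lin_comp (@smash_scale_linr f) (@smash_act_linr X)).
rewrite (smash_scaleE f) 2!smash_actE scD 3!smash_scaleE.
by rewrite derM tD addrA.
Qed.

Let mul_l t u : linear (fun f => smash_scale f (uact u t)).
Proof. exact: smash_scale_linl. Qed.

Let mul_r t f : linear (fun u => smash_scale f (uact u t)).
Proof. exact: lin_comp (@smash_scale_linr f) (@uact_linl t). Qed.

Lemma smash_mulE f u t : smash_mul (f # u) t = smash_scale f (uact u t).
Proof.
rewrite /smash_mul unlock.
by apply: tensor_liftE => [n|m]; [apply: mul_l | apply: mul_r].
Qed.

Lemma smash_mul_linl t : linear (smash_mul^~ t).
Proof.
rewrite /smash_mul unlock.
by apply: tensor_lift_linear => [n|m]; [apply: mul_l | apply: mul_r].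
Qed.

Lemma smash_mul_linr s : linear (smash_mul s).
Proof.
move=> c x y; move: s; apply: smash_ext => [||a u].
- exact: smash_mul_linl.
- exact: lin_comb (@smash_mul_linl x) (@smash_mul_linl y) c.
by rewrite 3!smash_mulE uact_linr smash_scale_linr.
Qed.

Lemma smash_mul_scale f s t :
  smash_mul (smash_scale f s) t = smash_scale f (smash_mul s t).
Proof.
move: s; apply: smash_ext => [||a u].
- exact: lin_comp (@smash_mul_linl t) (@smash_scale_linr f).
- exact: lin_comp (@smash_scale_linr f) (@smash_mul_linl t).
by rewrite smash_scaleE 2!smash_mulE smash_scaleA.
Qed.

Lemma smash_mul_act1 X s t :
  smash_mul (smash_act X s) t = smash_act X (smash_mul s t).
Proof.
have mD a b : smash_mul (a + b) t = smash_mul a t + smash_mul b t.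
  exact: linD (@smash_mul_linl t) a b.
move: s; apply: smash_ext => [||a u].
- exact: lin_comp (@smash_mul_linl t) (@smash_act_linr X).
- exact: lin_comp (@smash_act_linr X) (@smash_mul_linl t).
rewrite smash_actE mD 3!smash_mulE smash_act_scale.
have -> : uact (env_inj X * u) t = smash_act X (uact u t).
  by rewrite -(env_act_inj smash_act_module); exact: env_actM smash_act_module _ _ _.
by [].
Qed.

Lemma smash_mul_act u s t : smash_mul (uact u s) t = uact u (smash_mul s t).
Proof.
exact: (env_act_morph smash_act_module smash_act_module (@smash_mul_linl t)
  (fun X s => smash_mul_act1 X s t)).
Qed.

Lemma smash_mulA : associative smash_mul.
Proof.
move=> x y z; move: x; apply: smash_ext => [||a u].
- exact: smash_mul_linl.
- exact: lin_comp (@smash_mul_linl z) (@smash_mul_linl y).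
by rewrite 2!smash_mulE smash_mul_scale smash_mul_act.
Qed.

Lemma smash_act_1tensor u v : uact u (1 # v) = 1 # (u * v).
Proof.
have E X (w : U) : 1 # env_regular X w = smash_act X (1 # w).
  by rewrite smash_actE der1 (lin0 (@tl w)) add0r.
have := env_act_morph (@env_regular_module _ _) smash_act_module (@tr 1) E u v.
by rewrite env_act_regular => ->.
Qed.

Lemma smash_mul1 : left_id smash_one smash_mul.
Proof.
by move=> t; rewrite smash_mulE smash_scale1 (env_act1 smash_act_module).
Qed.

Lemma smash_1mul : right_id smash_one smash_mul.
Proof.
apply: smash_ext => [||a u] //; first exact: smash_mul_linl.
by rewrite smash_mulE smash_act_1tensor smash_scaleE !mulr1.
Qed.

Lemma smash_mulDl : left_distributive smash_mul +%R.
Proof. by move=> x y z; exact: linD (@smash_mul_linl z) x y. Qed.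

Lemma smash_mulDr : right_distributive smash_mul +%R.
Proof. by move=> x y z; exact: linD (@smash_mul_linr x) y z. Qed.

Lemma smash_one_neq0 : smash_one != 0.
Proof.
have h : lie_module (fun (_ : g) (_ : F^o) => 0).
  by split=> [v a x y|x a u v|x y v]; rewrite ?scaler0 ?addr0 ?subrr.
pose e (u : U) : F := env_act (fun (_ : g) (_ : F^o) => 0) u 1.
have el : linear (e : U -> F^o) by exact: (env_act_linl h 1).
have bl u : linear (fun f : A => e u *: f).
  by move=> c x y; rewrite scalerDr !scalerA mulrC.
have br (f : A) : linear (fun u => e u *: f).
  by move=> c x y; rewrite el scalerDl scalerA.
apply/eqP => s0; have := tensor_liftE bl br 1 1.
rewrite -[ptensor 1 1]/smash_one s0 (lin0 (tensor_lift_linear bl br)).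
rewrite /e -[1]/(env_one g) (env_act1 h) scale1r => /eqP.
by rewrite eq_sym oner_eq0.
Qed.

HB.instance Definition _ := GRing.Zmodule_isNzRing.Build smash
  smash_mulA smash_mul1 smash_1mul smash_mulDl smash_mulDr smash_one_neq0.

Lemma smash_scalerAl (a : F) (x y : smash) : a *: (x * y) = (a *: x) * y.
Proof. exact/esym/(linZ (smash_mul_linl y)). Qed.

Lemma smash_scalerAr (a : F) (x y : smash) : a *: (x * y) = x * (a *: y).
Proof. exact/esym/(linZ (smash_mul_linr x)). Qed.

HB.instance Definition _ := GRing.Lmodule_isLalgebra.Build F smash smash_scalerAl.
HB.instance Definition _ := GRing.Lalgebra_isAlgebra.Build F smash smash_scalerAr.
End Smash.

Notation "f # u" := (smash_tensor f u) (at level 30) : ring_scope.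

(* Together with bilinearity and associativity, smash_algM, smash_envM,
   smash_alg_env and smash_der_alg determine the product. *)
Section SmashRelations.
Context (F : comNzRingType) (A : comAlgType F).
Local Notation g := (der A).

Lemma smash_tensor_linl (u : env g) : linear (fun f : A => f # u).
Proof. exact: ptensor_linl. Qed.

Lemma smash_tensor_linr (f : A) : linear (smash_tensor f).
Proof. exact: ptensor_linr. Qed.

Lemma smash_algM (f h : A) : (f # 1) * (h # 1) = (f * h) # 1.
Proof.
rewrite [LHS]smash_mulE (env_act1 (@smash_act_module F A)).
by rewrite smash_scaleE.
Qed.

Lemma smash_envM (u v : env g) : (1 # u) * (1 # v) = 1 # (u * v).
Proof. by rewrite [LHS]smash_mulE smash_act_1tensor smash_scale1. Qed.

Lemma smash_alg_env (f : A) (u : env g) : (f # 1) * (1 # u) = f # u.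
Proof.
rewrite [LHS]smash_mulE (env_act1 (@smash_act_module F A)).
by rewrite smash_scaleE mulr1.
Qed.

Lemma smash_der_alg (X : g) (f : A) :
  (1 # env_inj X) * (f # 1) = f # env_inj X + X f # 1.
Proof.
rewrite [LHS]smash_mulE (env_act_inj (@smash_act_module F A)).
by rewrite smash_scale1 smash_actE mulr1 addrC.
Qed.

Definition smash_lie (x y : smash A) : smash A := x * y - y * x.

Lemma smash_lie_linl y a (u v : smash A) :
  smash_lie (a *: u + v) y = a *: smash_lie u y + smash_lie v y.
Proof.
rewrite /smash_lie mulrDl mulrDr -scalerAl -scalerAr scalerBr opprD.
by rewrite addrACA.
Qed.

Lemma smash_lie_linr x a (u v : smash A) :
  smash_lie x (a *: u + v) = a *: smash_lie x u + smash_lie x v.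
Proof.
rewrite /smash_lie mulrDl mulrDr -scalerAl -scalerAr scalerBr opprD.
by rewrite addrACA.
Qed.

Lemma smash_liexx x : smash_lie x x = 0.
Proof. exact: subrr. Qed.

Lemma smash_lie_jacobi x y z :
  smash_lie x (smash_lie y z) + smash_lie y (smash_lie z x)
    + smash_lie z (smash_lie x y) = 0.
Proof.
rewrite /smash_lie !mulrBr !mulrBl !mulrA !opprB !addrA.
rewrite (AC 12%AC ((1*12)*(2*7)*(3*10)*(4*5)*(6*11)*(8*9))%AC).
by rewrite /= !(subrr, addNr, addr0).
Qed.

HB.instance Definition _ := Lmodule_isLieAlgebra.Build F (smash A)
  smash_lie_linl smash_lie_linr smash_liexx smash_lie_jacobi.
End SmashRelations.

Section Laurent.
Context (F : comNzRingType).

Definition laurent : Type := monoid_alg F (int * nat)%type.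

HB.instance Definition _ := GRing.ComAlgebra.on laurent.

(* tpow (m1, m2) is t1^m1 * t2^m2 *)
Definition tpow (m : int * nat) : laurent := mono F m.

Definition pd1 : laurent -> laurent :=
  mlin (fun m => m.1%:~R *: tpow (m.1 - 1, m.2)).
Definition pd2 : laurent -> laurent :=
  mlin (fun m => m.2%:R *: tpow (m.1, m.2.-1)).

Lemma pd1_tpow m : pd1 (tpow m) = m.1%:~R *: tpow (m.1 - 1, m.2).
Proof. by rewrite /pd1 [tpow m]monoE mlinU scale1r. Qed.

Lemma pd2_tpow m : pd2 (tpow m) = m.2%:R *: tpow (m.1, m.2.-1).
Proof. by rewrite /pd2 [tpow m]monoE mlinU scale1r. Qed.

Lemma tpowM m n : tpow m * tpow n = tpow (m.1 + n.1, (m.2 + n.2)%N).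
Proof. exact: monoM. Qed.

Lemma leibniz_ext (D : laurent -> laurent) : linear D ->
  (forall m n, D (tpow m * tpow n) = D (tpow m) * tpow n + tpow m * D (tpow n)) ->
  forall f h, D (f * h) = D f * h + f * D h.
Proof.
have ml h : linear (fun f : laurent => f * h).
  by move=> a u v; rewrite mulrDl scalerAl.
have mr f : linear (fun h : laurent => f * h).
  by move=> a u v; rewrite mulrDr scalerAr.
move=> Dl H f h; move: f; apply: mono_ext => [||m].
- exact: lin_comp Dl (ml h).
- exact: lin_add (lin_comp (ml h) Dl) (ml (D h)).
move: h; apply: mono_ext => [||n]; last exact: H.
- exact: lin_comp Dl (mr _).
- exact: lin_add (mr _) (lin_comp (mr _) Dl).
Qed.

Lemma pd1_der : pd1 \in @derivation F laurent.
Proof.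
apply: der_mem => [|f h]; first exact: mlin_linear.
apply: leibniz_ext => [|m n]; first exact: mlin_linear.
rewrite tpowM !pd1_tpow -scalerAl -scalerAr !tpowM /= addrA [m.1 - 1 + _]addrAC.
by rewrite -scalerDl rmorphD.
Qed.

Lemma pd2_der : pd2 \in @derivation F laurent.
Proof.
apply: der_mem => [|f h]; first exact: mlin_linear.
apply: leibniz_ext => [|[m i] [n j]]; first exact: mlin_linear.
rewrite tpowM !pd2_tpow -scalerAl -scalerAr !tpowM /=.
case: i j => [|i] [|j]; rewrite /= ?addn0 ?add0n ?addSn ?addnS ?scale0r ?add0r ?addr0 //.
by rewrite -scalerDl -natrD addSn addnS.
Qed.

Definition dt1 : der laurent := Der pd1_der.
Definition dt2 : der laurent := Der pd2_der.

(* Only k = 1 and k = 2 are meaningful. *)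
Definition dt (k : nat) : der laurent := if k == 1%N then dt1 else dt2.

Definition kron (i j : nat) : nat := (i == j).

Definition Xelt (k : nat) (m : int * nat) : smash laurent :=
  \sum_(0 <= i < m.2.+1)
     ((-1) ^+ i * 'C(m.2, i)%:R) *:
       (tpow (- m.1, i) # env_inj (tpow (m.1 + (kron k 1)%:Z, (m.2 - i)%N) *d dt k))
  - (kron m.2 0)%:R *: (1 # env_inj (tpow ((kron k 1)%:Z, 0%N) *d dt k)).

Definition Lalg : set (smash laurent) := span (range (Xelt 1) `|` range (Xelt 2)).

(* The ideal generated by t1 - 1 and t2. *)
Definition m10 : set laurent :=
  [set f | exists a b, f = a * (tpow (1, 0%N) - 1) + b * tpow (0, 1%N)].

Definition m10Delta : set (der laurent) :=
  span ([set f *d dt 1 | f in m10] `|` [set f *d dt 2 | f in m10]).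

Definition defines_theta (theta : smash laurent -> der laurent) : Prop :=
  [/\ linear_on Lalg theta,
      forall m, theta (Xelt 1 m) =
        ((tpow m - (kron m.2 0)%:R) * tpow (1, 0%N)) *d dt 1 &
      forall m, theta (Xelt 2 m) = (tpow m - (kron m.2 0)%:R) *d dt 2].
End Laurent.

Arguments laurent F : clear implicits.
Arguments Lalg F : clear implicits.
Arguments m10 F : clear implicits.
Arguments m10Delta F : clear implicits.
Arguments dt {F} k.
Arguments tpow {F} m.
Arguments Xelt {F} k m.

(* Main.v *)
From HB Require Import structures.
Require Import Defs.
From mathcomp Require Import all_boot all_order all_algebra.
From mathcomp Require Import boolp classical_sets functions reals.
From mathcomp Require Import complex monalg.

(** Write delta_1 = t1 d/dt1 and delta_2 = d/dt2. These are two commuting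
derivations of A, invariant under translations for the group law
(s1, s2).(t1, t2) = (s1 t1, s2 + t2) on C^* x C. Read an element a (x) b of A (x) A as the function a(t) b(s) of two
points t and s of that group. The substitution f |-> f(t^-1 s), called sigma
below, sends t1 to t1^-1 (x) t1 and t2 to 1 (x) t2 - t2 (x) 1, and the binomial
theorem shows that

  X_k(m) = Phi_k (sigma (t^m - delta_(m2,0))),

where Phi_k sends a (x) b to a . (b delta_k) in A # U(g) ([Xelt_embed]). As
delta_(m2,0) is the value of t^m at the identity (1, 0), the functions
t^m - delta_(m2,0) span the kernel of the evaluation ev at that point, which is
the maximal ideal m_(1,0) ([m10P]). So L is the set of all
Phi_1 (sigma f) + Phi_2 (sigma g) with ev f = ev g = 0 ([LalgP]), and theta has
to be the map that sends it to f delta_1 + g delta_2.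

Brackets. The commutator of Phi_D x and Phi_E y in A # U(g) has two kinds of
terms ([realize_lie]). In the first kind, the vector field on one side
differentiates the left tensor factor on the other; its coefficient is moved
into that left factor, so that the other tensor appears only through its
restriction to the diagonal s = t. The restriction of f(t^-1 s) to the diagonal
is the constant f(1, 0), so these terms vanish on L. The second kind is the
bracket of vector fields in the right factor. There delta_k, applied in the
variable s, commutes with sigma, because it is unchanged by translations
([delta1_equivariant], [delta2_equivariant]). What remains is

  [Phi_D (sigma f), Phi_E (sigma g)]
    = Phi_E (sigma (f D g)) - Phi_D (sigma (g E f)),

which is the bracket [f D, g E] of vector fields ([realize_sigma_lie],
[der_lie_scale]). This shows at once that L is closed under the bracket and
that theta is a homomorphism.

Existence and injectivity. A linear map on L cannot be defined by its values on
the X_k(m) before one knows their linear relations. Instead theta is defined on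
all of A # U(g): f . u sends a function h to ev(f) u(h), with U(g) acting on A
by differential operators, and theta x is the vector field whose values on the
coordinates t1 and t2 are those of this operator. Since evaluating t in
f(t^-1 s) at the identity returns f(s), theta sends Phi_k (sigma f) to
f delta_k, so f and g can be read off from the image. *)

Set Implicit Arguments.
Unset Strict Implicit.
Unset Printing Implicit Defensive.

Import GRing.Theory.

Local Open Scope classical_set_scope.
Local Open Scope ring_scope.

(** * Submodules, linear and bilinear maps *)

Section Linear.
Context (F : comNzRingType).

Definition bilinear_map (V W T : lmodType F) (b : V -> W -> T) : Prop :=
  (forall w, linear (b^~ w)) /\ forall v, linear (b v).

Lemma submodule_add (V : lmodType F) (P : set V) u v :
  submodule P -> P u -> P v -> P (u + v).
Proof. by case=> _ PD Pu Pv; rewrite -[u]scale1r; apply: PD. Qed.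

Lemma submodule_scale (V : lmodType F) (P : set V) a u :
  submodule P -> P u -> P (a *: u).
Proof. by case=> P0 PD Pu; rewrite -[_ *: u]addr0; apply: PD. Qed.

Lemma submodule_opp (V : lmodType F) (P : set V) u :
  submodule P -> P u -> P (- u).
Proof. by move=> sP Pu; rewrite -scaleN1r; apply: submodule_scale. Qed.

Lemma submodule_preimage (V W : lmodType F) (h : V -> W) (P : set W) :
  linear h -> submodule P -> submodule (fun v => P (h v)).
Proof.
by move=> hl [P0 PD]; split=> [|a u v Pu Pv]; rewrite ?(lin0 hl) ?hl //; apply: PD.
Qed.

Lemma linear_add2 (V W : lmodType F) (h k : V -> W) : linear h -> linear k ->
  forall (a : F) u v u' v',
    a *: (h u + k v) + (h u' + k v') = h (a *: u + u') + k (a *: v + v').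
Proof. by move=> hl kl a u v u' v'; rewrite hl kl scalerDr addrACA. Qed.

Lemma linear_id (V : lmodType F) : linear (fun v : V => v).
Proof. by []. Qed.

Lemma mull_linear (R : algType F) (y : R) : linear (fun x : R => x * y).
Proof. by move=> a u v; rewrite mulrDl scalerAl. Qed.

Lemma mulr_linear (R : algType F) (x : R) : linear (fun y : R => x * y).
Proof. by move=> a u v; rewrite mulrDr scalerAr. Qed.

Lemma scale_linear (V : lmodType F) (v : V) : linear (fun c : F^o => c *: v).
Proof. by move=> a x y; rewrite scalerDl scalerA. Qed.

Lemma scaler_linear (V : lmodType F) (c : F) : linear (fun v : V => c *: v).
Proof. by move=> a x y; rewrite scalerDr !scalerA mulrC. Qed.

Lemma bilinear_comp_mul (R : algType F) (V : lmodType F) (f : V -> R) (g : V -> R) :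
  linear f -> linear g -> bilinear_map (fun x y => f x * g y).
Proof.
move=> fl gl; split=> [y|x].
  exact: lin_comp (mull_linear (g y)) fl.
exact: lin_comp (mulr_linear (f x)) gl.
Qed.

Lemma bilinear_map_comp (R : algType F) (W : lmodType F) (f : R -> W) :
  linear f -> bilinear_map (fun x y : R => f (x * y)).
Proof.
move=> fl; split=> [y|x].
  exact: lin_comp fl (mull_linear y).
exact: lin_comp fl (mulr_linear x).
Qed.

Lemma bilinear_comp (V W V' W' T : lmodType F) (b : V -> W -> T) f g :
  bilinear_map b -> linear f -> linear g ->
  bilinear_map (fun (x : V') (y : W') => b (f x) (g y)).
Proof.
move=> [bl br] fl gl; split=> [y|x].
  exact: lin_comp (bl (g y)) fl.
exact: lin_comp (br (f x)) gl.
Qed.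

Lemma bilinear_out (V W T T' : lmodType F) (b : V -> W -> T) (h : T -> T') :
  linear h -> bilinear_map b -> bilinear_map (fun x y => h (b x y)).
Proof.
by move=> hl [bl br]; split=> [y|x]; [exact: lin_comp hl (bl y) | exact: lin_comp hl (br x)].
Qed.

Lemma bilinear_swap (V W T : lmodType F) (b : V -> W -> T) :
  bilinear_map b -> bilinear_map (fun x y => b y x).
Proof. by case. Qed.

Lemma bilinear_add (V W T : lmodType F) (b c : V -> W -> T) :
  bilinear_map b -> bilinear_map c -> bilinear_map (fun x y => b x y + c x y).
Proof.
by move=> [bl br] [cl cr]; split=> [y|x]; [exact: lin_add (bl y) (cl y) | exact: lin_add (br x) (cr x)].
Qed.

Lemma bilinear_sub (V W T : lmodType F) (b c : V -> W -> T) :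
  bilinear_map b -> bilinear_map c -> bilinear_map (fun x y => b x y - c x y).
Proof.
by move=> [bl br] [cl cr]; split=> [y|x]; [exact: lin_sub (bl y) (cl y) | exact: lin_sub (br x) (cr x)].
Qed.

Lemma mono_ind (M : nmodType) (P : set (monoid_alg F M)) :
  submodule P -> (forall m, P (mono F m)) -> forall x, P x.
Proof.
move=> sP PM x; rewrite [x]monalgE.
elim/big_ind: _ => [|u v|k _]; first by case: sP.
  by move=> Pu Pv; exact: (submodule_add sP Pu Pv).
have -> : << x@_k *g k >> = mcoeff k x *: mono F k.
  rewrite monoE; apply/malgP => l.
  by rewrite mcoeffZ !mcoeffU mulrnAr mulr1.
exact: (submodule_scale _ sP (PM k)).
Qed.

End Linear.

(** * The tensor square of A *)

Section TensorSquare.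
Context (F : comNzRingType).
Local Notation A := (laurent F).

(** The tensor square A (x) A, as the monoid algebra of pairs of exponents: this
gives it its ring structure, and tens_lift its universal property. *)
Definition laurent2 : Type := monoid_alg F ((int * nat) * (int * nat))%type.
HB.instance Definition _ := GRing.ComAlgebra.on laurent2.
Local Notation A2 := laurent2.

Definition to_left : A -> A2 := mlin (fun p => mono F (p, 0)).

Definition to_right : A -> A2 := mlin (fun q => mono F (0, q)).

Definition tens (a b : A) : A2 := to_left a * to_right b.

Lemma to_left_tpow p : to_left (tpow p) = mono F (p, 0).
Proof. by rewrite /to_left [tpow p]monoE mlinU scale1r. Qed.

Lemma to_right_tpow p : to_right (tpow p) = mono F (0, p).
Proof. by rewrite /to_right [tpow p]monoE mlinU scale1r. Qed.

Lemma to_left_linear : linear to_left. Proof. exact: mlin_linear. Qed.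

Lemma to_right_linear : linear to_right. Proof. exact: mlin_linear. Qed.

Lemma tpow0 : tpow (0, 0%N) = 1 :> A. Proof. by []. Qed.

Lemma tens_bilinear : bilinear_map tens.
Proof.
split=> [b|a].
  exact: lin_comp (mull_linear (to_right b)) to_left_linear.
exact: lin_comp (mulr_linear (to_left a)) to_right_linear.
Qed.

Lemma tens_tpow p q : tens (tpow p) (tpow q) = mono F (p, q).
Proof.
rewrite /tens to_left_tpow to_right_tpow [LHS]monoM; congr (mono F _).
by rewrite -[LHS]/(p + 0, 0 + q) addr0 add0r.
Qed.

Lemma laurent_ext (W : lmodType F) (f g : A -> W) : linear f -> linear g ->
  (forall m, f (tpow m) = g (tpow m)) -> f =1 g.
Proof. exact: mono_ext. Qed.

Lemma laurent2_ext (W : lmodType F) (f g : A2 -> W) : linear f -> linear g ->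
  (forall a b, f (tens a b) = g (tens a b)) -> f =1 g.
Proof. by move=> fl gl fg; apply: mono_ext => // -[p q]; rewrite -tens_tpow. Qed.

Lemma laurent2_ext2 (W : lmodType F) (f g : A2 -> A2 -> W) :
  bilinear_map f -> bilinear_map g ->
  (forall a b c d, f (tens a b) (tens c d) = g (tens a b) (tens c d)) ->
  forall x y, f x y = g x y.
Proof.
move=> [fl fr] [gl gr] fg x y; move: x.
apply: laurent2_ext => [||a b]; [exact: fl | exact: gl |].
by move: y; apply: laurent2_ext => [||c d]; [exact: fr | exact: gr |].
Qed.

Lemma to_leftM a b : to_left (a * b) = to_left a * to_left b.
Proof.
move: a; apply: laurent_ext => [||p].
- exact: lin_comp to_left_linear (mull_linear b).
- exact: lin_comp (mull_linear (to_left b)) to_left_linear.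
move: b; apply: laurent_ext => [||q].
- exact: lin_comp to_left_linear (mulr_linear (tpow p)).
- exact: lin_comp (mulr_linear (to_left (tpow p))) to_left_linear.
by rewrite tpowM !to_left_tpow [RHS]monoM.
Qed.

Lemma to_rightM a b : to_right (a * b) = to_right a * to_right b.
Proof.
move: a; apply: laurent_ext => [||p].
- exact: lin_comp to_right_linear (mull_linear b).
- exact: lin_comp (mull_linear (to_right b)) to_right_linear.
move: b; apply: laurent_ext => [||q].
- exact: lin_comp to_right_linear (mulr_linear (tpow p)).
- exact: lin_comp (mulr_linear (to_right (tpow p))) to_right_linear.
by rewrite tpowM !to_right_tpow [RHS]monoM.
Qed.

Lemma to_left1 : to_left 1 = 1. Proof. exact: to_left_tpow. Qed.

Lemma to_right1 : to_right 1 = 1. Proof. exact: to_right_tpow. Qed.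

Lemma tensM a b c d : tens a b * tens c d = tens (a * c) (b * d).
Proof. by rewrite /tens to_leftM to_rightM mulrACA. Qed.

Lemma tens11 : tens 1 1 = 1 :> A2.
Proof. by rewrite /tens to_left1 to_right1 mulr1. Qed.

Definition tens_lift (W : lmodType F) (b : A -> A -> W) : A2 -> W :=
  mlin (fun k => b (tpow k.1) (tpow k.2)).

Lemma tens_lift_linear W b : linear (@tens_lift W b).
Proof. exact: mlin_linear. Qed.

Lemma tens_liftE (W : lmodType F) (f : A -> A -> W) : bilinear_map f ->
  forall a b, tens_lift f (tens a b) = f a b.
Proof.
move=> [fl fr] a b; have [tl tr] := tens_bilinear.
have ll := tens_lift_linear f.
move: a; apply: laurent_ext => [||p]; [exact: lin_comp ll (tl b) | exact: fl |].
move: b; apply: laurent_ext => [||q]; [exact: lin_comp ll (tr _) | exact: fr |].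
by rewrite tens_tpow /tens_lift monoE mlinU scale1r.
Qed.

End TensorSquare.

(** * Evaluation at (1, 0) and the substitution sigma *)

Section Substitution.
Context (F : comNzRingType).
Local Notation A := (laurent F).
Local Notation A2 := (laurent2 F).

(** Evaluation at the point t1 = 1, t2 = 0. *)
Definition ev : A -> F^o := mlin (fun m => (kron m.2 0)%:R : F^o).

Lemma ev_linear : linear ev. Proof. exact: mlin_linear. Qed.

Lemma ev_tpow m : ev (tpow m) = (kron m.2 0)%:R.
Proof. by rewrite /ev [tpow m]monoE mlinU scale1r. Qed.

Lemma ev1 : ev 1 = 1. Proof. exact: ev_tpow. Qed.

Lemma evM a b : ev (a * b) = (ev a : F) * ev b.
Proof.
have [l r] := bilinear_comp_mul (R := F^o) ev_linear ev_linear.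
move: a; apply: laurent_ext => [||p]; [|exact: l|].
  exact: lin_comp ev_linear (mull_linear b).
move: b; apply: laurent_ext => [||q]; [|exact: r|].
  exact: lin_comp ev_linear (mulr_linear _).
rewrite tpowM !ev_tpow -natrM; congr (_%:R); rewrite /kron.
by case: p.2 q.2 => [|?] [|?].
Qed.

Lemma ev_scale_bilinear (W V : lmodType F) (f : W -> V) :
  linear f -> bilinear_map (fun a w => ev a *: f w).
Proof.
move=> fl; split=> [b|a].
  exact: lin_comp (scale_linear (f b)) ev_linear.
exact: lin_comp (scaler_linear (ev a)) fl.
Qed.

(** Restriction to the diagonal. *)
Definition tmul : A2 -> A := tens_lift *%R.

Lemma tmul_linear : linear tmul. Proof. exact: tens_lift_linear. Qed.

Lemma tmul_tens a b : tmul (tens a b) = a * b.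
Proof.
by apply: tens_liftE; apply: (bilinear_comp_mul (R := A)); apply: linear_id.
Qed.

Lemma tmulM x y : tmul (x * y) = tmul x * tmul y.
Proof.
move: x y; apply: laurent2_ext2 => [||a b c d].
- exact: (bilinear_map_comp (R := A2) tmul_linear).
- exact: bilinear_comp_mul tmul_linear tmul_linear.
by rewrite tensM !tmul_tens mulrACA.
Qed.

(** Evaluation of the left variable at (1, 0). *)
Definition tev : A2 -> A := tens_lift (fun a b => ev a *: b).

Lemma tev_linear : linear tev. Proof. exact: tens_lift_linear. Qed.

Lemma tev_tens a b : tev (tens a b) = ev a *: b.
Proof. by apply: tens_liftE; apply: ev_scale_bilinear; apply: linear_id. Qed.

Lemma tevM x y : tev (x * y) = tev x * tev y.
Proof.
move: x y; apply: laurent2_ext2 => [||a b c d].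
- exact: bilinear_map_comp tev_linear.
- exact: bilinear_comp_mul tev_linear tev_linear.
by rewrite tensM !tev_tens evM -scalerAl -scalerAr scalerA.
Qed.

Definition derl (D : der A) : A2 -> A2 := tens_lift (fun a b => tens (D a) b).

Definition derr (D : der A) : A2 -> A2 := tens_lift (fun a b => tens a (D b)).

Lemma derl_linear D : linear (derl D). Proof. exact: tens_lift_linear. Qed.

Lemma derr_linear D : linear (derr D). Proof. exact: tens_lift_linear. Qed.

Lemma derl_tens D a b : derl D (tens a b) = tens (D a) b.
Proof.
have [tl tr] := tens_bilinear F.
apply: tens_liftE; split=> [c|c]; last exact: tr.
exact: lin_comp (tl c) (der_linear D).
Qed.

Lemma derr_tens D a b : derr D (tens a b) = tens a (D b).
Proof.
have [tl tr] := tens_bilinear F.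
apply: tens_liftE; split=> [c|c]; first exact: tl.
exact: lin_comp (tr c) (der_linear D).
Qed.

Lemma derrM D x y : derr D (x * y) = derr D x * y + x * derr D y.
Proof.
have [l1 r1] := bilinear_comp_mul (R := A2) (derr_linear D) (@linear_id _ A2).
have [l2 r2] := bilinear_comp_mul (R := A2) (@linear_id _ A2) (derr_linear D).
move: x y; apply: laurent2_ext2 => [||a b c d].
- exact: bilinear_map_comp (derr_linear D).
- split=> z; [exact: lin_add (l1 z) (l2 z) | exact: lin_add (r1 z) (r2 z)].
rewrite tensM !derr_tens !tensM derM.
exact: (linD ((tens_bilinear F).2 _)).
Qed.

Definition dif : A2 := to_right (tpow (0, 1%N)) - to_left (tpow (0, 1%N)).

(** f |-> f(t^-1 s) for the group law of C^* x C, where t is the variable of the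
left factor and s that of the right one. *)
Definition sigma : A -> A2 :=
  mlin (fun m => tens (tpow (- m.1, 0%N)) (tpow (m.1, 0%N)) * dif ^+ m.2).

Lemma sigma_linear : linear sigma. Proof. exact: mlin_linear. Qed.

Lemma sigma_tpow m :
  sigma (tpow m) = tens (tpow (- m.1, 0%N)) (tpow (m.1, 0%N)) * dif ^+ m.2.
Proof. by rewrite /sigma [tpow m]monoE mlinU scale1r. Qed.

Lemma difE : dif = tens 1 (tpow (0, 1%N)) - tens (tpow (0, 1%N)) 1.
Proof. by rewrite /tens to_left1 to_right1 mul1r mulr1. Qed.

Lemma sigma1 : sigma 1 = 1.
Proof. by rewrite -tpow0 sigma_tpow oppr0 tpow0 tens11 mulr1. Qed.

Lemma sigmaM f g : sigma (f * g) = sigma f * sigma g.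
Proof.
have [l r] := bilinear_comp_mul sigma_linear sigma_linear.
move: f; apply: laurent_ext => [||p]; [|exact: l|].
  exact: lin_comp sigma_linear (mull_linear g).
move: g; apply: laurent_ext => [||q]; [|exact: r|].
  exact: lin_comp sigma_linear (mulr_linear _).
rewrite tpowM !sigma_tpow /= mulrACA tensM -exprD.
by rewrite !tpowM /= opprD.
Qed.

(** t^-1 t is the identity (1, 0) of the group. *)
Lemma tmul_sigma f : tmul (sigma f) = ev f *: (1 : A).
Proof.
move: f; apply: laurent_ext => [||[m n]].
- exact: lin_comp tmul_linear sigma_linear.
- exact: lin_comp (scale_linear (1 : A)) ev_linear.
rewrite sigma_tpow tmulM tmul_tens tpowM addNr tpow0 mul1r ev_tpow /=.
have d0 : tmul dif = 0.
  by rewrite difE (linB tmul_linear) !tmul_tens mulr1 mul1r subrr.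
case: n => [|n]; last by rewrite exprS tmulM d0 mul0r scale0r.
by rewrite expr0 -tens11 tmul_tens mulr1 scale1r.
Qed.

(** Putting t = (1, 0) in f(t^-1 s) gives f(s). *)
Lemma tev_sigma f : tev (sigma f) = f.
Proof.
move: f; apply: laurent_ext => [||[m n]].
- exact: lin_comp tev_linear sigma_linear.
- exact: linear_id.
rewrite sigma_tpow tevM tev_tens ev_tpow /= scale1r.
have d0 : tev dif = tpow (0, 1%N).
  by rewrite difE (linB tev_linear) !tev_tens ev1 ev_tpow scale1r scale0r subr0.
have -> : tev (dif ^+ n) = tpow (0, n).
  elim: n => [|n IH]; first by rewrite expr0 -tens11 tev_tens ev1 scale1r.
  by rewrite exprS tevM d0 IH tpowM addr0.
by rewrite tpowM addr0 add0n.
Qed.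

(** The binomial expansion of (s2 - t2)^m2 is where the alternating sum in the
definition of X_k(m) comes from. *)
Lemma sigma_tpow_sum m : sigma (tpow m) =
  \sum_(0 <= i < m.2.+1) ((-1) ^+ i * 'C(m.2, i)%:R) *:
     tens (tpow (- m.1, i)) (tpow (m.1, (m.2 - i)%N)) :> A2.
Proof.
have to_leftX n : to_left (tpow (0, 1%N)) ^+ n = to_left (tpow (0, n)) :> A2.
  elim: n => [|n IH]; first by rewrite expr0 tpow0 to_left1.
  by rewrite exprS IH -to_leftM tpowM.
have to_rightX n : to_right (tpow (0, 1%N)) ^+ n = to_right (tpow (0, n)) :> A2.
  elim: n => [|n IH]; first by rewrite expr0 tpow0 to_right1.
  by rewrite exprS IH -to_rightM tpowM.
rewrite sigma_tpow exprBn mulr_sumr big_mkord; apply: eq_bigr => i _.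
rewrite to_leftX to_rightX -mulrA [to_right _ * _]mulrC.
rewrite -[to_left _ * to_right _]/(tens (tpow (0, i : nat)) (tpow (0, (m.2 - i)%N))).
rewrite -scaler_nat mulrC -scalerAl -mulrA [tens _ _ * _]mulrC tensM !tpowM /= !addr0 !add0n.
(* The sign lives in A (x) A after exprBn and among the scalars in X_k(m). *)
have sgnE (z : A2) : (-1) ^+ i * z = (-1 : F) ^+ i *: z.
  by rewrite -(signr_odd A2 i) -(signr_odd F i) mulr_sign scaler_sign.
by rewrite sgnE scalerA mulrC.
Qed.

Definition delta1 : der A := tpow (1, 0%N) *d dt1 F.

Definition delta2 : der A := dt2 F.

Lemma delta1_tpow m : delta1 (tpow m) = m.1%:~R *: tpow m.
Proof.
rewrite -[LHS]/(tpow (1, 0%N) * pd1 (tpow m)) pd1_tpow -scalerAr tpowM.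
by rewrite /= addrC subrK add0n -surjective_pairing.
Qed.

Lemma delta2_tpow m : delta2 (tpow m) = m.2%:R *: tpow (m.1, m.2.-1).
Proof. exact: pd2_tpow. Qed.

Lemma delta_comm : lie delta1 delta2 = 0.
Proof.
apply: derP; apply: laurent_ext => [||m].
- exact: der_linear.
- exact: der_linear.
rewrite -[LHS]/(delta1 (delta2 (tpow m)) - delta2 (delta1 (tpow m))).
rewrite delta1_tpow delta2_tpow (linZ (der_linear _)) (linZ (der_linear delta2)).
by rewrite delta1_tpow delta2_tpow !scalerA mulrC subrr.
Qed.

(** D commutes with translations of the group: applied in the variable s, it
commutes with f |-> f(t^-1 s). *)
Definition sigma_equivariant (D : der A) : Prop :=
  forall g, derr D (sigma g) = sigma (D g).

Lemma derr_dif D : derr D dif = to_right (D (tpow (0, 1%N))).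
Proof.
rewrite difE (linB (derr_linear D)) !derr_tens der1.
by rewrite (lin0 ((tens_bilinear F).2 _)) subr0 /tens to_left1 mul1r.
Qed.

(** s1 d/ds1 does not change when s1 is rescaled to t1^-1 s1. *)
Lemma delta1_equivariant : sigma_equivariant delta1.
Proof.
apply: laurent_ext => [||[m n]].
- exact: lin_comp (derr_linear _) sigma_linear.
- exact: lin_comp sigma_linear (der_linear _).
have dX k : derr delta1 (dif ^+ k) = 0.
  elim: k => [|k IH]; first by rewrite expr0 -tens11 derr_tens der1 (lin0 ((tens_bilinear F).2 _)).
  by rewrite exprS derrM IH derr_dif delta1_tpow scale0r (lin0 (@to_right_linear F)) mul0r mulr0 addr0.
rewrite delta1_tpow (linZ sigma_linear) sigma_tpow derrM dX mulr0 addr0.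
by rewrite derr_tens delta1_tpow (linZ ((tens_bilinear F).2 _)) -scalerAl.
Qed.

(** d/ds2 does not change when s2 is translated to s2 - t2. *)
Lemma delta2_equivariant : sigma_equivariant delta2.
Proof.
apply: laurent_ext => [||[m n]].
- exact: lin_comp (derr_linear _) sigma_linear.
- exact: lin_comp sigma_linear (der_linear _).
have dX k : derr delta2 (dif ^+ k) = k%:R *: dif ^+ k.-1.
  elim: k => [|k IH].
    by rewrite expr0 -tens11 derr_tens der1 (lin0 ((tens_bilinear F).2 _)) scale0r.
  rewrite exprS derrM IH derr_dif delta2_tpow scale1r to_right1 mul1r -scalerAr.
  case: k {IH} => [|k]; first by rewrite scale0r addr0 scale1r.
  by rewrite -exprS -[in RHS]nat1r scalerDl scale1r.
rewrite delta2_tpow (linZ sigma_linear) !sigma_tpow derrM dX derr_tens delta2_tpow.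
by rewrite scale0r (lin0 ((tens_bilinear F).2 _)) mul0r add0r scalerAr.
Qed.

End Substitution.

(** * Commutators of first-order elements of the smash product *)

Section Smash.
Context (F : comNzRingType).
Local Notation A := (laurent F).
Local Notation A2 := (laurent2 F).

Lemma der_scale_linear (D : der A) : linear (fun f : A => f *d D).
Proof.
move=> a u v; apply: derP => f; rewrite der_addE.
by rewrite -[LHS]/((a *: u + v) * D f) mulrDl -scalerAl.
Qed.

Lemma der_scaleA (a b : A) (D : der A) : a *d (b *d D) = (a * b) *d D.
Proof.
by apply: derP => f; rewrite -[LHS]/(a * (b * D f)) mulrA.
Qed.

Lemma der_lie_scale (D E : der A) (a b : A) : lie D E = 0 ->
  lie (a *d D) (b *d E) = (a * D b) *d E - (b * E a) *d D.
Proof.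
move=> /(congr1 (@der_fun _ _)) /(congr1 (@^~ _)) DE; apply: derP => f.
rewrite -[LHS]/(a * D (b * E f) - b * E (a * D f)).
rewrite -[RHS]/(a * D b * E f - b * E a * D f) !derM !mulrDr.
have /eqP : D (E f) - E (D f) = 0 by exact: DE.
by rewrite subr_eq0 => /eqP ->; rewrite !mulrA [b * a]mulrC opprD addrACA subrr addr0.
Qed.

Lemma smash_first_orderM (a c : A) (X Y : der A) :
  (a # env_inj X) * (c # env_inj Y) =
  (a * c) # (env_inj X * env_inj Y) + (a * X c) # env_inj Y.
Proof.
rewrite -[a # env_inj X]smash_alg_env -[c # env_inj Y]smash_alg_env.
rewrite mulrA -[_ * _ * (c # 1)]mulrA smash_der_alg mulrDr mulrDl.
rewrite -[c # env_inj X]smash_alg_env mulrA !smash_algM -mulrA smash_envM.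
by rewrite !smash_alg_env.
Qed.

Lemma smash_first_order_lie (a c : A) (X Y : der A) :
  lie (a # env_inj X) (c # env_inj Y) =
  (a * X c) # env_inj Y - (c * Y a) # env_inj X + (a * c) # env_inj (lie X Y).
Proof.
rewrite -[LHS]/(_ * _ - _ * _) !smash_first_orderM env_inj_lie.
rewrite (linB (smash_tensor_linr _)) [c * a]mulrC opprD.
by rewrite addrACA [RHS]addrC.
Qed.

(** The map Phi_D: the left factor of a tensor provides the element of A, the
right one the coefficient of the vector field. *)
Definition realize (D : der A) : A2 -> smash A :=
  tens_lift (fun a b => a # env_inj (b *d D)).

Lemma realize_linear D : linear (realize D).
Proof. exact: tens_lift_linear. Qed.

Lemma realize_tens D a b : realize D (tens a b) = a # env_inj (b *d D).
Proof.
apply: tens_liftE; split=> [c|c]; first exact: smash_tensor_linl.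
apply: lin_comp (smash_tensor_linr c) _.
exact: lin_comp (@env_inj_linear _ _) (der_scale_linear D).
Qed.

Lemma lie_bilinear (G : lieAlgType F) : bilinear_map (@lie F G).
Proof.
by split=> [y|x] a u v; [exact: lie_linl | exact: lie_linr].
Qed.

(** Each half comes from one factor differentiating the other. The vector field
b D acts on the left factor c through D c, with b moved to the left, where the
product a b is a value of tmul; on the right factor it acts as in the bracket
of vector fields. *)
Lemma realize_lie (D E : der A) x y : lie D E = 0 ->
  lie (realize D x) (realize E y) =
    realize E (to_left (tmul x) * derl D y + x * derr D y)
    - realize D (to_left (tmul y) * derl E x + y * derr E x).
Proof.
move=> DE; pose half (D' : der A) (u v : A2) : A2 :=
  to_left (tmul u) * derl D' v + u * derr D' v.
have half_bil D' : bilinear_map (half D').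
  have tl := lin_comp (@to_left_linear F) (@tmul_linear F).
  have h1 := bilinear_comp_mul tl (derl_linear D').
  have h2 := bilinear_comp_mul (@linear_id F A2) (derr_linear D').
  exact: bilinear_add h1 h2.
rewrite -/(half D x y) -/(half E y x); move: x y.
apply: laurent2_ext2 => [||a b c d].
- exact: bilinear_comp (lie_bilinear _) (realize_linear D) (realize_linear E).
- apply: bilinear_sub; first exact: bilinear_out (realize_linear E) (half_bil D).
  exact: bilinear_out (realize_linear D) (bilinear_swap (half_bil E)).
rewrite /half !realize_tens smash_first_order_lie (der_lie_scale _ _ DE).
rewrite !tmul_tens !derl_tens !derr_tens !tensM.
have to_left_tens (u v w : A) : to_left u * tens v w = tens (u * v) w.
  by rewrite /tens mulrA to_leftM.
rewrite !to_left_tens !(linD (realize_linear _)) !realize_tens.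
rewrite -[(b *d D) c]/(b * D c) -[(d *d E) a]/(d * E a) !mulrA.
rewrite (linB (@env_inj_linear _ _)) (linB (smash_tensor_linr _)) [c * a]mulrC.
by rewrite opprD addrACA.
Qed.

(** The diagonal terms of realize_lie disappear because tmul (sigma f) is the
constant ev f = 0. *)
Lemma realize_sigma_lie (D E : der A) f g :
  lie D E = 0 -> sigma_equivariant D -> sigma_equivariant E -> ev f = 0 -> ev g = 0 ->
  lie (realize D (sigma f)) (realize E (sigma g)) =
    realize E (sigma (f * D g)) - realize D (sigma (g * E f)).
Proof.
move=> DE Di Ei f0 g0; rewrite (realize_lie _ _ DE) !tmul_sigma f0 g0 !scale0r.
by rewrite (lin0 (@to_left_linear F)) !mul0r !add0r Di Ei -!sigmaM.
Qed.

End Smash.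

(** * L and m_(1,0) Delta in terms of functions vanishing at (1, 0) *)

Section Spans.
Context (F : comNzRingType).
Local Notation A := (laurent F).
Local Notation A2 := (laurent2 F).

Definition center (f : A) : A := f - ev f *: (1 : A).

Lemma center_linear : linear center.
Proof.
exact: lin_sub (@linear_id F A) (lin_comp (scale_linear (1 : A)) (@ev_linear F)).
Qed.

Lemma ev_center f : ev (center f) = 0.
Proof.
by rewrite (linB (@ev_linear F)) (linZ (@ev_linear F)) ev1 [_ *: _]mulr1 subrr.
Qed.

Lemma center_id f : ev f = 0 -> center f = f.
Proof. by move=> f0; rewrite /center f0 scale0r subr0. Qed.

Lemma center_tpow m : center (tpow m) = tpow m - (kron m.2 0)%:R.
Proof. by rewrite /center ev_tpow scaler_nat. Qed.

Definition embed (D : der A) (f : A) : smash A := realize D (sigma f).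

Lemma embed_linear D : linear (embed D).
Proof. exact: lin_comp (realize_linear D) (@sigma_linear F). Qed.

(** The hypothesis says that t1^[k = 1] d/dt_k is D; it is stated on coefficients,
in the form in which they occur in the definition of X_k(m). *)
Lemma Xelt_embed k (D : der A) :
  (forall (n : int) j, tpow (n, j) *d D = tpow (n + (kron k 1)%:Z, j) *d dt k) ->
  forall m, embed D (center (tpow m)) = Xelt k m.
Proof.
move=> kD m; rewrite (linB (embed_linear D)) (linZ (embed_linear D)) ev_tpow.
have -> : embed D 1 = 1 # env_inj (tpow ((kron k 1)%:Z, 0%N) *d dt k).
  rewrite /embed sigma1 -[(kron k 1)%:Z]add0r -kD.
  have -> : 1 = tens 1 (tpow (0, 0%N)) :> A2 by rewrite tpow0 tens11.
  exact: realize_tens.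
have -> : embed D (tpow m) =
  \sum_(0 <= i < m.2.+1) ((-1) ^+ i * 'C(m.2, i)%:R) *:
    (tpow (- m.1, i) # env_inj (tpow (m.1 + (kron k 1)%:Z, (m.2 - i)%N) *d dt k)).
  rewrite /embed sigma_tpow_sum (lin_sum (realize_linear D)); apply: eq_bigr => i _.
  by rewrite (linZ (realize_linear D)) realize_tens kD.
reflexivity.
Qed.

Lemma Xelt1E m : Xelt 1 m = embed (delta1 F) (center (tpow m)).
Proof.
by apply/esym/Xelt_embed => n j; rewrite /delta1 der_scaleA tpowM /= addn0.
Qed.

Lemma Xelt2E m : Xelt 2 m = embed (delta2 F) (center (tpow m)).
Proof. by apply/esym/Xelt_embed => n j; rewrite addr0. Qed.

(** A function vanishing at (1, 0) is its own image under center, so it is a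
combination of the functions t^m - delta_(m2,0) which define the X_k(m). *)
Lemma LalgP x : Lalg F x <->
  exists f g, [/\ ev f = 0, ev g = 0 & x = embed (delta1 F) f + embed (delta2 F) g].
Proof.
have e1 := embed_linear (delta1 F); have e2 := embed_linear (delta2 F).
have evl := @ev_linear F.
split.
  move: x; apply: span_ind.
    split=> [|a u v [f [g [f0 g0 ->]]] [f' [g' [f0' g0' ->]]]].
      by exists 0, 0; rewrite (lin0 e1) (lin0 e2) addr0 (lin0 evl).
    exists (a *: f + f'), (a *: g + g').
    rewrite !evl f0 g0 f0' g0' scaler0 addr0; split=> //.
    exact: (linear_add2 e1 e2).
  move=> _ [] [m _ <-].
    exists (center (tpow m)), 0.
    by rewrite ev_center (lin0 evl) (lin0 e2) addr0 Xelt1E.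
  exists 0, (center (tpow m)).
  by rewrite ev_center (lin0 evl) (lin0 e1) add0r Xelt2E.
have sL : submodule (Lalg F) by exact: span_submodule.
have EL D : linear (embed D) -> (forall m, Lalg F (embed D (center (tpow m)))) ->
    forall f, ev f = 0 -> Lalg F (embed D f).
  move=> el h f f0; rewrite -(center_id f0) {f0}.
  move: f; apply: (mono_ind _ h).
  exact: submodule_preimage (lin_comp el center_linear) sL.
move=> [f [g [f0 g0 ->]]]; apply: (submodule_add sL).
  apply: EL => // m; rewrite -Xelt1E; apply: span_gen; left; exact: imageT.
apply: EL => // m; rewrite -Xelt2E; apply: span_gen; right; exact: imageT.
Qed.

(** The kernel of the evaluation is spanned by the t^m - delta_(m2,0). For m2 > 0
these are multiples of t2, and t1^n - 1 is a multiple of t1 - 1, also for n < 0,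
because t1 is invertible. *)
Lemma m10P f : m10 F f <-> ev f = 0.
Proof.
have evl := @ev_linear F.
split=> [[a [b ->]]|f0].
  rewrite (linD evl) !evM (linB evl) ev1 !ev_tpow.
  by rewrite subrr !mulr0 addr0.
have m10Z c h : m10 F h -> m10 F (c * h).
  by move=> [a [b ->]]; exists (c * a), (c * b); rewrite mulrDr !mulrA.
have m10D h h' : m10 F h -> m10 F h' -> m10 F (h + h').
  move=> [a [b ->]] [a' [b' ->]]; exists (a + a'), (b + b').
  by rewrite !mulrDl addrACA.
have m10t1 (n : nat) : m10 F (tpow (n%:Z, 0%N) - 1).
  elim: n => [|n IH]; first by exists 0, 0; rewrite subrr !mul0r addr0.
  have -> : tpow (n.+1%:Z, 0%N) - 1 =
      tpow (1, 0%N) * (tpow (n%:Z, 0%N) - 1) + (tpow (1, 0%N) - 1) :> A.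
    by rewrite mulrBr tpowM mulr1 addrA subrK.
  by apply: m10D (m10Z _ _ IH) _; exists 1, 0; rewrite mul1r mul0r addr0.
rewrite -(center_id f0) {f0}.
have m10_submodule : submodule (m10 F).
  split=> [|a u v hu hv]; first by exists 0, 0; rewrite !mul0r addr0.
  by apply: m10D hv; rewrite -mulr_algl; apply: m10Z.
move: f; apply: mono_ind (submodule_preimage center_linear m10_submodule) _ => -[k j].
rewrite [center _]center_tpow /=; case: j => [|j]; last first.
  exists 0, (tpow (k, j)).
  by rewrite mul0r add0r subr0 tpowM addr0 addn1.
case: k => n; first exact: m10t1.
have -> : tpow (Negz n, 0%N) - 1%:R = - tpow (Negz n, 0%N) * (tpow (n.+1%:Z, 0%N) - 1) :> A.
  by rewrite mulrBr mulr1 mulNr tpowM NegzE addNr opprK addrC.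
exact: m10Z.
Qed.

Lemma Lalg_submodule : submodule (Lalg F).
Proof. exact: span_submodule. Qed.

Lemma Lalg_embed1 f : ev f = 0 -> Lalg F (embed (delta1 F) f).
Proof.
move=> f0; apply/LalgP; exists f, 0.
by rewrite (lin0 (@ev_linear F)) (lin0 (embed_linear _)) addr0.
Qed.

Lemma Lalg_embed2 f : ev f = 0 -> Lalg F (embed (delta2 F) f).
Proof.
move=> f0; apply/LalgP; exists 0, f.
by rewrite (lin0 (@ev_linear F)) (lin0 (embed_linear _)) add0r.
Qed.

End Spans.

(** * The isomorphism *)

Section Isomorphism.
Context (F : comNzRingType).
Local Notation A := (laurent F).

Lemma der_lie_module : lie_module (fun (X : der A) (f : A) => X f).
Proof.
by split=> [f a X Y|X|X Y f]; [exact: der_addE | exact: der_linear |].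
Qed.

(** As a function of g, this is the operator ev(f) u for the natural action of
U(g) on A. That action is faithful on vector fields, so the operator still knows
the vector field X when u is the image of X in U(g). *)
Definition apply_at (g : A) : smash A -> A :=
  tensor_lift (fun f u => ev f *: env_act (fun (X : der A) (h : A) => X h) u g).

Let act_linear (g : A) :
  linear (fun u => env_act (fun (X : der A) (h : A) => X h) u g).
Proof. exact: env_act_linl der_lie_module g. Qed.

Lemma apply_at_linear g : linear (apply_at g).
Proof.
have [l r] := ev_scale_bilinear (act_linear g).
by apply: tensor_lift_linear; [exact: l | exact: r].
Qed.

Lemma apply_at_tensor g f X : apply_at g (f # env_inj X) = ev f *: X g.
Proof.
have [l r] := ev_scale_bilinear (act_linear g).
rewrite [LHS]tensor_liftE; [|exact: l|exact: r].
by rewrite (env_act_inj der_lie_module).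
Qed.

Lemma apply_at_embed g D f : apply_at g (embed D f) = f * D g.
Proof.
rewrite -[in RHS](tev_sigma f) /embed; move: (sigma f).
apply: laurent2_ext => [||a b].
- exact: lin_comp (apply_at_linear g) (realize_linear D).
- exact: lin_comp (mull_linear (D g)) (@tev_linear F).
by rewrite realize_tens apply_at_tensor tev_tens -scalerAl.
Qed.

(** The vector field with the same values on the coordinates t1 and t2 as the
operator attached to x. Being defined on the whole smash product, it needs no
knowledge of the linear relations between the X_k(m). *)
Definition theta (x : smash A) : der A :=
  apply_at (tpow (1, 0%N)) x *d dt1 F + apply_at (tpow (0, 1%N)) x *d dt2 F.

Lemma theta_linear : linear theta.
Proof.
exact: lin_add (lin_comp (der_scale_linear _) (apply_at_linear _))
               (lin_comp (der_scale_linear _) (apply_at_linear _)).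
Qed.

Lemma dt1_tpow m : dt1 F (tpow m) = m.1%:~R *: tpow (m.1 - 1, m.2).
Proof. exact: pd1_tpow. Qed.

Lemma theta_embed1 f : theta (embed (delta1 F) f) = f *d delta1 F.
Proof.
rewrite /theta !apply_at_embed !delta1_tpow scale1r scale0r mulr0.
by rewrite (lin0 (der_scale_linear _)) addr0 /delta1 der_scaleA.
Qed.

Lemma theta_embed2 f : theta (embed (delta2 F) f) = f *d delta2 F.
Proof.
rewrite /theta !apply_at_embed !delta2_tpow scale1r scale0r mulr0.
by rewrite (lin0 (der_scale_linear _)) add0r tpow0 mulr1.
Qed.

(** Closure of L under a bracket and compatibility of h with it are kept together,
since both are additive in x and y and have to be checked on the same pairs. *)
Definition lie_hom_at (G H : lieAlgType F) (L : set G) (h : G -> H) x y : Prop :=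
  L (lie x y) /\ h (lie x y) = lie (h x) (h y).

Lemma lie_hom_atDl (G H : lieAlgType F) (L : set G) (h : G -> H) u v y :
  linear h -> submodule L ->
  lie_hom_at L h u y -> lie_hom_at L h v y -> lie_hom_at L h (u + v) y.
Proof.
move=> hl sL [Lu hu] [Lv hv]; rewrite /lie_hom_at.
rewrite (linD ((lie_bilinear G).1 y)) !(linD hl) (linD ((lie_bilinear H).1 (h y))).
by rewrite hu hv; split=> //; exact: submodule_add.
Qed.

Lemma lie_hom_atDr (G H : lieAlgType F) (L : set G) (h : G -> H) u v y :
  linear h -> submodule L ->
  lie_hom_at L h y u -> lie_hom_at L h y v -> lie_hom_at L h y (u + v).
Proof.
move=> hl sL [Lu hu] [Lv hv]; rewrite /lie_hom_at.
rewrite (linD ((lie_bilinear G).2 y)) !(linD hl) (linD ((lie_bilinear H).2 (h y))).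
by rewrite hu hv; split=> //; exact: submodule_add.
Qed.

Lemma lie_eq0_sym (G : lieAlgType F) (x y : G) : lie x y = 0 -> lie y x = 0.
Proof.
have [l r] := lie_bilinear G => xy0; have := liexx (x + y).
by rewrite (linD (l (x + y))) !(linD (r _)) !liexx xy0 addr0 addr0 add0r.
Qed.

(** Both brackets are f D(g) E - g E(f) D, one through realize_sigma_lie and the
other through der_lie_scale; ev is multiplicative, so the new coefficients
vanish at (1, 0) again. *)
Lemma embed_lie_hom (D E : der A) f g :
  lie D E = 0 -> sigma_equivariant D -> sigma_equivariant E ->
  (forall h, ev h = 0 -> Lalg F (embed D h) /\ theta (embed D h) = h *d D) ->
  (forall h, ev h = 0 -> Lalg F (embed E h) /\ theta (embed E h) = h *d E) ->
  ev f = 0 -> ev g = 0 -> lie_hom_at (Lalg F) theta (embed D f) (embed E g).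
Proof.
move=> DE Di Ei hD hE f0 g0; rewrite /lie_hom_at.
have [Lf ->] := hD _ f0; have [Lg ->] := hE _ g0.
have f1 : ev (f * D g) = 0 by rewrite evM f0 mul0r.
have g1 : ev (g * E f) = 0 by rewrite evM g0 mul0r.
have [L1 t1] := hE _ f1; have [L2 t2] := hD _ g1.
rewrite [lie (embed D f) _]realize_sigma_lie // (linB theta_linear) t1 t2 der_lie_scale //.
split=> //; apply: submodule_add (@Lalg_submodule F) L1 _.
exact: submodule_opp (@Lalg_submodule F) L2.
Qed.

Lemma theta_lie x y : Lalg F x -> Lalg F y -> lie_hom_at (Lalg F) theta x y.
Proof.
have h1 h : ev h = 0 ->
    Lalg F (embed (delta1 F) h) /\ theta (embed (delta1 F) h) = h *d delta1 F.
  by split; [exact: Lalg_embed1 | exact: theta_embed1].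
have h2 h : ev h = 0 ->
    Lalg F (embed (delta2 F) h) /\ theta (embed (delta2 F) h) = h *d delta2 F.
  by split; [exact: Lalg_embed2 | exact: theta_embed2].
have inv1 := @delta1_equivariant F; have inv2 := @delta2_equivariant F.
have tl := theta_linear; have sL := @Lalg_submodule F.
move=> /LalgP [f [g [f0 g0 ->]]] /LalgP [f' [g' [f0' g0' ->]]].
apply: (lie_hom_atDl tl sL); apply: (lie_hom_atDr tl sL).
- exact: (embed_lie_hom (liexx _) inv1 inv1 h1 h1 f0 f0').
- exact: (embed_lie_hom (delta_comm F) inv1 inv2 h1 h2 f0 g0').
- exact: (embed_lie_hom (lie_eq0_sym (delta_comm F)) inv2 inv1 h2 h1 g0 f0').
- exact: (embed_lie_hom (liexx _) inv2 inv2 h2 h2 g0 g0').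
Qed.

Lemma apply_at_Lalg f g :
  apply_at (tpow (1, 0%N)) (embed (delta1 F) f + embed (delta2 F) g)
    = f * tpow (1, 0%N) /\
  apply_at (tpow (0, 1%N)) (embed (delta1 F) f + embed (delta2 F) g) = g.
Proof.
rewrite !(linD (apply_at_linear _)) !apply_at_embed !delta1_tpow !delta2_tpow.
by rewrite !scale1r !scale0r !mulr0 addr0 add0r tpow0 mulr1.
Qed.

Lemma der_scale_evall (B : comAlgType F) (a b u : B) (D E : der B) :
  D u = 1 -> E u = 0 -> (a *d D + b *d E) u = a.
Proof.
by move=> Du Eu; rewrite -[LHS]/(a * D u + b * E u) Du Eu mulr1 mulr0 addr0.
Qed.

Lemma der_scale_evalr (B : comAlgType F) (a b u : B) (D E : der B) :
  D u = 0 -> E u = 1 -> (a *d D + b *d E) u = b.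
Proof.
by move=> Du Eu; rewrite -[LHS]/(a * D u + b * E u) Du Eu mulr1 mulr0 add0r.
Qed.

Lemma theta_coord x : theta x (tpow (1, 0%N)) = apply_at (tpow (1, 0%N)) x /\
  theta x (tpow (0, 1%N)) = apply_at (tpow (0, 1%N)) x.
Proof.
split; [apply: der_scale_evall | apply: der_scale_evalr].
- by rewrite dt1_tpow scale1r.
- by rewrite [LHS]delta2_tpow scale0r.
- by rewrite dt1_tpow scale0r.
- by rewrite [LHS]delta2_tpow scale1r.
Qed.

Lemma tpow1_unit : tpow (1, 0%N) * tpow (-1, 0%N) = 1 :> A.
Proof. by rewrite tpowM. Qed.

(** Injectivity: the values of theta x on t1 and t2 are f t1 and g, and t1 is
invertible. Surjectivity: f d/dt1 is f t1^-1 delta_1. *)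
Lemma theta_bij : set_bij (Lalg F) (m10Delta F) theta.
Proof.
have sM : submodule (m10Delta F) by exact: span_submodule.
split.
- move=> _ /= /LalgP [f [g [f0 g0 ->]]].
  rewrite (linD theta_linear) theta_embed1 theta_embed2 /delta1 der_scaleA.
  apply: (submodule_add sM); apply: span_gen; [left|right].
    by exists (f * tpow (1, 0%N)) => //; apply/m10P; rewrite evM f0 mul0r.
  by exists g => //; apply/m10P.
- move=> x x' /set_mem /LalgP [f [g [_ _ xE]]] /set_mem /LalgP [f' [g' [_ _ xE']]] e.
  have [a1 a2] := apply_at_Lalg f g; have [b1 b2] := apply_at_Lalg f' g'.
  have [c1 c2] := theta_coord x; have [d1 d2] := theta_coord x'.
  rewrite -xE in a1 a2; rewrite -xE' in b1 b2.
  have ff : f * tpow (1, 0%N) = f' * tpow (1, 0%N).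
    by rewrite -a1 -b1 -c1 -d1 e.
  have gg : g = g' by rewrite -a2 -b2 -c2 -d2 e.
  have {}ff : f = f'.
    by rewrite -[f]mulr1 -[f']mulr1 -tpow1_unit !mulrA ff.
  by rewrite xE xE' ff gg.
- have im : submodule (theta @` Lalg F).
    split=> [|a _ _ [u Lu <-] [v Lv <-]].
      by exists 0; [case: (@Lalg_submodule F) | exact: lin0 theta_linear].
    exists (a *: u + v); last exact: theta_linear.
    by apply: (@Lalg_submodule F).2.
  apply: (span_ind im) => _ [] [f /m10P f0 <-].
    exists (embed (delta1 F) (f * tpow (-1, 0%N))).
      by apply: Lalg_embed1; rewrite evM f0 mul0r.
    rewrite theta_embed1 /delta1 der_scaleA -mulrA [_ * tpow (1, _)]mulrC.
    by rewrite tpow1_unit mulr1.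
  by exists (embed (delta2 F) f); [exact: Lalg_embed2 | exact: theta_embed2].
Qed.

Lemma theta_defines : defines_theta theta.
Proof.
split=> [a x y _ _|m|m]; first exact: theta_linear.
  by rewrite Xelt1E theta_embed1 center_tpow /delta1 der_scaleA.
by rewrite Xelt2E theta_embed2 center_tpow.
Qed.

Lemma theta_unique theta' : defines_theta theta' ->
  forall x, Lalg F x -> theta' x = theta x.
Proof.
move=> [l' h1' h2']; have [l h1 h2] := theta_defines.
have sL := @Lalg_submodule F.
have sP : submodule (fun x => Lalg F x /\ theta' x = theta x).
  split=> [|a u v [Lu hu] [Lv hv]].
    have L0 : Lalg F 0 by case: sL.
    split=> //; have := l' 1 0 0 L0 L0; rewrite scale1r addr0 (lin0 theta_linear).
    by rewrite scale1r -[X in X = _ -> _]addr0 => /addrI ->.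
  by split; [exact: sL.2 | rewrite l' // l // hu hv].
move=> x Lx; suff [] : Lalg F x /\ theta' x = theta x by [].
move: x Lx; apply: (span_ind sP) => _ [] [m _ <-].
  by rewrite h1 h1'; split=> //; apply: span_gen; left; exact: imageT.
by rewrite h2 h2'; split=> //; apply: span_gen; right; exact: imageT.
Qed.

End Isomorphism.

Theorem lemma3p3 (R : realType) :
  [/\ lie_subalgebra (Lalg R[i]),
      lie_subalgebra (m10Delta R[i]) &
      exists theta : smash (laurent R[i]) -> der (laurent R[i]),
        [/\ defines_theta theta,
            lie_iso (Lalg R[i]) (m10Delta R[i]) theta &
            forall theta', defines_theta theta' ->
              forall x, Lalg R[i] x -> theta' x = theta x]].
Proof.
have [tM _ tS] := theta_bij R[i].
split.
- split=> [|x y Lx Ly]; first exact: Lalg_submodule.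
  by case: (theta_lie Lx Ly).
- split=> [|x y]; first exact: span_submodule.
  (* m_(1,0) Delta is the image of L, so it inherits the closure of L. *)
  move=> /tS [u Lu <-] /tS [v Lv <-].
  by case: (theta_lie Lu Lv) => Luv <-; apply: tM.
exists (@theta R[i]); split; first exact: theta_defines.
  split; last exact: theta_bij.
    by move=> a x y _ _; exact: theta_linear.
  by move=> x y Lx Ly; case: (theta_lie Lx Ly).
exact: theta_unique.
Qed.
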